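(* Let $\mathbf{X}_1,\mathbf{X}_0$ be computable metric spaces with recognizable Boolean inclusions, with fixed universal randomness tests (both denoted $\mathbf{t}$), and let $\Lambda=\{\lambda_x:x\in X_1\}$ be a computable probability kernel from $\mathbf{X}_1$ to $\mathbf{X}_0$. Then there is a constant $c>0$ such that for all $\mu\in\mathcal{M}(\mathbf{X}_1)$ and $x\in X_1$, $$\int \mathbf{t}_{\Lambda^*\mu}(y)\,\lambda_x(dy)\le c\,\mathbf{t}_\mu(x).$$
   Context: Computable metric space $(X,d,D,\alpha)$: complete separable metric space with countable dense $D$ enumerated by $\alpha$, with $d(\alpha(v),\alpha(w))$ computable; basis: balls $B(u,r)$, $u\in D$, $r>0$ rational. Recognizable Boolean inclusions: the set of pairs of finite index sets $(S,T)$ with $\bigcap_{i\in S}U_i\subseteq\bigcup_{j\in T}U_j$ (the $U_i$ the enumerated basis balls) is r.e. $\mathcal{M}(\mathbf{X})$: Borel probability measures with the weak topology, a computable metric space under the Prokhorov distance with dense set the finitely supported rational-weight measures on $D$. Lower semicomputable $f$: $\{(z,r):f(z)>r\}$ is r.e. open. A randomness test on $\mathbf{X}$ is a lower semicomputable $(\mu,x)\mapsto f_\mu(x)\in[0,\infty]$ with $\int f_\mu d\mu\le1$ for all $\mu$; a universal test $\mathbf{t}$ is a test such that every test $f$ satisfies $c_f f\le\mathbf{t}$ for some $c_f>0$. A probability kernel from $X_1$ to $X_0$ is a family of Borel probability measures $\lambda_x$ on $X_0$ with $x\mapsto\lambda_x(B)$ measurable for each Borel $B$; $\Lambda^*\mu$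 is the measure $B\mapsto\int\lambda_x(B)\mu(dx)$. Let $\mathcal{E}=\{g_1,g_2,\dots\}$ be the enumerated smallest set of functions on $X_0$ containing the constant $1$ and all functions $g_{u,r,1/n}(x)=\max\bigl(0,1-n\max(0,d(x,u)-r)\bigr)$ ($u\in D_0$, $r\in\mathbb{Q}$, $n\ge1$) and closed under $\max$, $\min$ and rational linear combinations. The kernel is computable if $(i,x)\mapsto\int g_i\,d\lambda_x$ is computable. *)

(* Defs.v *)
From Stdlib Require Cantor.
From HB Require Import structures.
From mathcomp Require Import all_boot all_order all_algebra.
From mathcomp Require Import all_classical all_reals all_analysis.
Set Implicit Arguments.
Unset Strict Implicit.
Unset Printing Implicit Defensive.
Import Order.TTheory GRing.Theory Num.Theory.
Import numFieldNormedType.Exports.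
Local Open Scope classical_set_scope.
Local Open Scope ring_scope.

Definition npair (a b : nat) : nat := Cantor.to_nat (a, b).
Definition nfst (n : nat) : nat := (Cantor.of_nat n).1.
Definition nsnd (n : nat) : nat := (Cantor.of_nat n).2.

(* Kleene's partial recursive functions in unary form, several arguments being
   packed with the Cantor pairing. *)
Inductive prf : Type :=
| PZero | PSucc | PFst | PSnd
| PPair of prf & prf
| PComp of prf & prf
| PPrec of prf & prf
| PMu of prf.

(* [prf_eval c n m]: the partial function computed by [c] is defined at [n],
   with value [m].  In the recursion case, s 0 = f(x), s (i+1) = g(x, i, s i),
   and the value at (x, k) is s k. *)
Fixpoint prf_eval (c : prf) (n m : nat) : Prop :=
  match c with
  | PZero => m = 0%N
  | PSucc => m = n.+1
  | PFst => m = nfst n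
  | PSnd => m = nsnd n
  | PPair f g => exists a b,
      [/\ prf_eval f n a, prf_eval g n b & m = npair a b]
  | PComp f g => exists2 k, prf_eval g n k & prf_eval f k m
  | PPrec f g => exists s : nat -> nat,
      [/\ prf_eval f (nfst n) (s 0%N),
          forall i, (i < nsnd n)%N ->
            prf_eval g (npair (nfst n) (npair i (s i))) (s i.+1)
        & m = s (nsnd n)]
  | PMu f => prf_eval f (npair n m) 0%N /\
      forall i, (i < m)%N -> exists v, prf_eval f (npair n i) v.+1
  end.

Definition re_set (A : set nat) : Prop :=
  exists c : prf, A = [set n | exists m, prf_eval c n m].

Lemma npairK a b : (nfst (npair a b) = a) * (nsnd (npair a b) = b).
Proof. by rewrite /nfst /nsnd /npair Cantor.cancel_of_to. Qed.

Lemma nunpairK n : npair (nfst n) (nsnd n) = n.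
Proof.
by rewrite /npair /nfst /nsnd -surjective_pairing Cantor.cancel_to_of.
Qed.

Lemma prf_eval_fun c n m m' : prf_eval c n m -> prf_eval c n m' -> m = m'.
Proof.
elim: c n m m' => [||||f IHf g IHg|f IHf g IHg|f IHf g IHg|f IHf] n m m' /=;
  do ?by move=> -> ->.
- move=> [a [b [fa gb ->]]] [a' [b' [fa' gb' ->]]].
  by rewrite (IHf _ _ _ fa fa') (IHg _ _ _ gb gb').
- move=> [k gk fm] [k' gk' fm'].
  by rewrite (IHg _ _ _ gk gk') in fm; apply: IHf fm fm'.
- move=> [s [s0 sS ->]] [s' [s'0 s'S ->]].
  suff: forall i, (i <= nsnd n)%N -> s i = s' i by apply.
  elim=> [_|i IHi ltin]; first exact: IHf s0 s'0.
  by apply: IHg (sS _ ltin) _; rewrite IHi ?(ltnW ltin)//; exact: s'S.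
- move=> [fm mlt] [fm' mlt']; case: (ltngtP m m') => //.
  + by move=> /mlt'[v] /IHf/(_ fm).
  + by move=> /mlt[v] /IHf/(_ fm').
Qed.

Definition rat_of_nat (n : nat) : rat :=
  ((nfst n)%:R - (nfst (nsnd n))%:R) / (nsnd (nsnd n)).+1%:R.

Definition prat_of_nat (n : nat) : rat := (nfst n).+1%:R / (nsnd n).+1%:R.

(* 0 codes [::] and (npair a b).+1 codes a :: (the list coded by b); as
   b < (npair a b).+1, the fuel n is never exhausted. *)
Fixpoint seq_of_nat_rec (fuel n : nat) : seq nat :=
  match fuel, n with
  | k.+1, p.+1 => nfst p :: seq_of_nat_rec k (nsnd p)
  | _, _ => [::]
  end.
Definition seq_of_nat (n : nat) : seq nat := seq_of_nat_rec n n.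

Lemma nfst_le n : (nfst n <= n)%N.
Proof.
have := Cantor.to_nat_non_decreasing (nfst n) (nsnd n).
rewrite -/(npair _ _) nunpairK => /ssrnat.leP.
by apply: leq_trans; rewrite plusE leq_addl.
Qed.

Lemma nsnd_le n : (nsnd n <= n)%N.
Proof.
have := Cantor.to_nat_non_decreasing (nfst n) (nsnd n).
rewrite -/(npair _ _) nunpairK => /ssrnat.leP.
by apply: leq_trans; rewrite plusE leq_addr.
Qed.

Lemma nsnd_lt n : (0 < nfst n)%N -> (nsnd n < n)%N.
Proof.
have := Cantor.to_nat_non_decreasing (nfst n) (nsnd n).
rewrite -/(npair _ _) nunpairK => /ssrnat.leP + f0.
by apply: leq_trans; rewrite plusE -addn1 leq_add2l.
Qed.

Lemma seq_of_nat0 : seq_of_nat 0 = [::].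
Proof. by []. Qed.

Lemma seq_of_natS n : seq_of_nat n.+1 = nfst n :: seq_of_nat (nsnd n).
Proof.
have fuelE k : forall p j, (p <= k)%N -> (p <= j)%N ->
    seq_of_nat_rec k p = seq_of_nat_rec j p.
  elim: k => [|k IH] [|p] [|j]//= pk pj; congr (_ :: _).
  by apply: IH; rewrite (leq_trans (nsnd_le p)).
by rewrite /seq_of_nat /=; congr (_ :: _); apply: fuelE => //; exact: nsnd_le.
Qed.

Lemma seq_of_nat_surj (s : seq nat) : exists n, seq_of_nat n = s.
Proof.
elim: s => [|a s [n ns]]; first by exists 0%N.
by exists (npair a n).+1; rewrite seq_of_natS !npairK ns.
Qed.

Lemma rat_of_nat_surj (q : rat) : exists n, rat_of_nat n = q.
Proof.
have dE : (denq q)%:~R = ((`|denq q|%N.-1).+1)%:R :> rat.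
  by rewrite prednK ?absz_gt0// pmulrn gez0_abs// ltW.
case: (leP 0 q) => [q0|q0].
- exists (npair `|numq q| (npair 0 `|denq q|.-1)).
  rewrite /rat_of_nat !npairK subr0 -dE -[RHS]divq_num_den; congr (_ / _).
  by rewrite pmulrn gez0_abs// numq_ge0.
- exists (npair 0 (npair `|numq q| `|denq q|.-1)).
  rewrite /rat_of_nat !npairK sub0r -dE -[RHS]divq_num_den; congr (_ / _).
  by rewrite pmulrn ltz0_abs ?numq_lt0// rmorphN opprK.
Qed.

Lemma prat_of_nat_surj (q : rat) : 0 < q -> exists n, prat_of_nat n = q.
Proof.
move=> q0; exists (npair `|numq q|.-1 `|denq q|.-1).
rewrite /prat_of_nat !npairK !prednK ?absz_gt0// ?numq_eq0 ?gt_eqF//.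
by rewrite !pmulrn !gez0_abs ?divq_num_den// ?numq_ge0 ltW.
Qed.

(* A space [Z] is given effectively by a numbered basis [nat -> set Z]; the
   r.e. open sets are the r.e. unions of basis elements. *)

Definition prod_basis {Y Z : Type} (U : nat -> set Y) (V : nat -> set Z)
  (n : nat) : set (Y * Z) := U (nfst n) `*` V (nsnd n).

Definition nat_basis (n : nat) : set nat := [set n].

Definition ball_basis {R : realType} {Z : Type} (d : Z -> Z -> R)
    (a : nat -> Z) (n : nat) : set Z :=
  [set z | d (a (nfst n)) z < ratr (prat_of_nat (nsnd n))].

Definition real_basis (R : realType) : nat -> set R :=
  ball_basis (fun x y : R => `|x - y|) (fun i => ratr (rat_of_nat i)).

Definition re_open {Z : Type} (U : nat -> set Z) (G : set Z) : Prop :=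
  exists2 A : set nat, re_set A & G = \bigcup_(i in A) U i.

(* The preimages of the basic open sets are r.e. open, uniformly. *)
Definition computable_map {Y Z : Type} (U : nat -> set Y) (V : nat -> set Z)
    (f : Y -> Z) : Prop :=
  exists2 W : set nat, re_set W &
    forall j, f @^-1` V j = \bigcup_(i in [set i | W (npair i j)]) U i.

Definition lower_semicomputable {R : realType} {Z : Type} (U : nat -> set Z)
    (f : Z -> \bar R) : Prop :=
  re_open (prod_basis U (@real_basis R)) [set zr | (zr.2%:E < f zr.1)%E].

#[short(type="completeMetricType")]
HB.structure Definition CompleteMetric (R : numDomainType) :=
  { M of Metric R M & Complete M }.

Record cmspace (R : realType) := CMSpace {
  cm_sort :> completeMetricType R;
  cm_alpha : nat -> cm_sort;
  cm_dense : dense (range cm_alpha);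
  cm_dist : exists c : prf, forall v w k : nat, exists2 q : nat,
    prf_eval c (npair (npair v w) k) q &
    `|mdist (cm_alpha v) (cm_alpha w) - ratr (rat_of_nat q)| <= 2 ^- k
}.

Arguments cm_alpha {R} c n : rename.

Definition cm_basis {R : realType} (X : cmspace R) : nat -> set X :=
  ball_basis (@mdist R X) (cm_alpha X).

Arguments cm_basis {R} X n.

Definition recognizable_boolean_inclusions {R : realType} (X : cmspace R) :=
  re_set [set n | \bigcap_(i in [set` seq_of_nat (nfst n)]) cm_basis X i `<=`
                  \bigcup_(j in [set` seq_of_nat (nsnd n)]) cm_basis X j].

Definition cm_pointed {R : realType} (X : cmspace R) : Type := X.
HB.instance Definition _ (R : realType) (X : cmspace R) :=
  Choice.on (cm_pointed X).
HB.instance Definition _ (R : realType) (X : cmspace R) :=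
  isPointed.Build (cm_pointed X) (cm_alpha X 0).

Definition borel {R : realType} (X : cmspace R) : measurableType _ :=
  @g_sigma_algebraType (cm_pointed X) (@open X).

(* Elements that agree on all Borel sets may still differ, as functions, on
   other sets; they are at Prokhorov distance 0, so no numbered ball, and
   hence no lower semicomputable function, separates them. *)
Definition pmeas {R : realType} (X : cmspace R) : Type :=
  probability (borel X) R.

Definition prokhorov {R : realType} {X : cmspace R} (mu nu : pmeas X) : R :=
  let nbh (A : set (borel X)) (e : R) : set (borel X) :=
    [set x | exists2 y, A y & mdist (x : X) (y : X) < e] in
  inf [set e : R | 0 < e /\ forall A : set (borel X), measurable A ->
    (mu A <= nu (nbh A e) + e%:E)%E /\ (nu A <= mu (nbh A e) + e%:E)%E].

(* The list s_0, s_1, .. codes the measure proportional to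
   sum_k w_k delta_(alpha i_k), where s_k = npair i_k w_k; when all weights
   vanish, the Dirac measure at alpha 0. *)
Definition pmeas_alpha {R : realType} (X : cmspace R) (n : nat) : pmeas X :=
  let s := seq_of_nat n in
  mnormalize
    (msum (fun k => mscale ((nsnd (nth 0%N s k))%:R%:nng : {nonneg R})
             (@dirac _ (borel X) (cm_alpha X (nfst (nth 0%N s k))) R))
          (size s))
    (@dirac _ (borel X) (cm_alpha X 0) R).

Arguments pmeas_alpha {R} X n.

Definition pmeas_basis {R : realType} (X : cmspace R) : nat -> set (pmeas X) :=
  ball_basis (@prokhorov R X) (pmeas_alpha X).

Arguments pmeas_basis {R} X n.

Definition randomness_test {R : realType} (X : cmspace R)
    (f : pmeas X -> X -> \bar R) : Prop :=
  [/\ forall mu x, (0 <= f mu x)%E,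
      lower_semicomputable (prod_basis (pmeas_basis X) (cm_basis X))
        (fun mx => f mx.1 mx.2)
    & forall mu : pmeas X, (\int[mu]_(x in [set: borel X]) f mu x <= 1)%E].

Definition universal_test {R : realType} (X : cmspace R)
    (t : pmeas X -> X -> \bar R) : Prop :=
  randomness_test t /\
  forall f, randomness_test f -> exists2 c : R, 0 < c &
    forall mu x, (c%:E * f mu x <= t mu x)%E.

Section kernel_push.
Local Open Scope ereal_scope.
Context d d' (X : measurableType d) (Y : measurableType d') (R : realType).
Variables (L : R.-pker X ~> Y) (mu : probability X R).

Definition kernel_push (B : set Y) : \bar R := \int[mu]_x L x B.

Let push0 : kernel_push set0 = 0.
Proof. by rewrite /kernel_push integral0_eq. Qed.

Let push_ge0 B : 0 <= kernel_push B.
Proof. exact: integral_ge0. Qed.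

Let push_sigma_additive : semi_sigma_additive kernel_push.
Proof.
move=> F mF tF mUF; rewrite [X in _ --> X](_ : _ =
    \int[mu]_x (\sum_(0 <= k <oo) L x (F k))); last first.
  apply: eq_integral => x _; apply/esym/cvg_lim => //.
  exact: measure_semi_sigma_additive.
rewrite [X in X @ _](_ : _ =
    (fun n => \int[mu]_x (\sum_(0 <= i < n) L x (F i)))); last first.
  apply/funext => n; rewrite -ge0_integral_sum// => i.
  exact: measurable_kernel.
apply: cvg_monotone_convergence => //.
- by move=> n; apply: emeasurable_sum => i; exact: measurable_kernel.
- by move=> n x _; rewrite sume_ge0.
- by move=> x _ m n mn; exact: ereal_nondecreasing_series.
Qed.

HB.instance Definition _ := isMeasure.Build _ _ _ kernel_push
  push0 push_ge0 push_sigma_additive.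

Let push_setT : kernel_push setT = 1.
Proof.
rewrite /kernel_push (eq_integral (cst 1)); last first.
  by move=> x _; rewrite prob_kernel.
by rewrite integral_cst// mul1e; exact: probability_setT.
Qed.

HB.instance Definition _ :=
  Measure_isProbability.Build _ _ _ kernel_push push_setT.

End kernel_push.

Definition pmeas_push {R : realType} {X1 X0 : cmspace R}
    (L : R.-pker (borel X1) ~> (borel X0)) (mu : pmeas X1) : pmeas X0 :=
  kernel_push L mu.

Section hat_functions.
Context {R : realType} (X : cmspace R).

Definition hat (u : X) (r : rat) (n : nat) (x : X) : R :=
  Num.max 0 (1 - n%:R * Num.max 0 (mdist x u - ratr r)).

(* The smallest set with these closure properties; [hat_fun] below is its
   enumeration, see [range_hat_fun]. *)
Inductive hat_class : set (X -> R) :=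
| hat_class1 : hat_class (fun=> 1)
| hat_class_hat i r n : (0 < n)%N -> hat_class (hat (cm_alpha X i) r n)
| hat_class_max f g : hat_class f -> hat_class g ->
    hat_class (fun x => Num.max (f x) (g x))
| hat_class_min f g : hat_class f -> hat_class g ->
    hat_class (fun x => Num.min (f x) (g x))
| hat_class_lin (a b : rat) f g : hat_class f -> hat_class g ->
    hat_class (fun x => ratr a * f x + ratr b * g x).

(* The first component of a code tells the last clause of [hat_class] used,
   the second one codes its parameters. *)
Fixpoint hat_fun_rec (fuel n : nat) : X -> R :=
  if fuel is k.+1 then
    let p := nsnd n in
    match nfst n with
    | 0 => fun=> 1
    | 1 => hat (cm_alpha X (nfst p)) (rat_of_nat (nfst (nsnd p)))
             (nsnd (nsnd p)).+1
    | 2 => fun x =>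
        Num.max (hat_fun_rec k (nfst p) x) (hat_fun_rec k (nsnd p) x)
    | 3 => fun x =>
        Num.min (hat_fun_rec k (nfst p) x) (hat_fun_rec k (nsnd p) x)
    | _ => fun x =>
        ratr (rat_of_nat (nfst (nfst p))) * hat_fun_rec k (nfst (nsnd p)) x +
        ratr (rat_of_nat (nsnd (nfst p))) * hat_fun_rec k (nsnd (nsnd p)) x
    end
  else fun=> 1.

Definition hat_fun (n : nat) : X -> R := hat_fun_rec n.+1 n.

Lemma hat_funE n : hat_fun n =
  let p := nsnd n in
  match nfst n with
  | 0 => fun=> 1
  | 1 => hat (cm_alpha X (nfst p)) (rat_of_nat (nfst (nsnd p)))
           (nsnd (nsnd p)).+1
  | 2 => fun x => Num.max (hat_fun (nfst p) x) (hat_fun (nsnd p) x)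
  | 3 => fun x => Num.min (hat_fun (nfst p) x) (hat_fun (nsnd p) x)
  | _ => fun x =>
      ratr (rat_of_nat (nfst (nfst p))) * hat_fun (nfst (nsnd p)) x +
      ratr (rat_of_nat (nsnd (nfst p))) * hat_fun (nsnd (nsnd p)) x
  end.
Proof.
have fuelE k : forall m j, (m < k)%N -> (m < j)%N ->
    hat_fun_rec k m = hat_fun_rec j m.
  elim: k => [//|k IH] m [//|j] mk mj.
  have lt1 i : (0 < nfst m)%N -> (i <= nsnd m)%N ->
      hat_fun_rec k i = hat_fun_rec j i.
    move=> m0 im; have im' := leq_ltn_trans im (nsnd_lt m0).
    by apply: IH; exact: leq_trans im' _.
  rewrite /=; case: (nfst m) lt1 => [//|[//|[|[|t]]]] lt1.
  - by rewrite !lt1// ?nfst_le ?nsnd_le.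
  - by rewrite !lt1// ?nfst_le ?nsnd_le.
  - by rewrite !lt1// ?(leq_trans (nfst_le _) (nsnd_le _))
      ?(leq_trans (nsnd_le _) (nsnd_le _)).
have lt1 i : (0 < nfst n)%N -> (i <= nsnd n)%N ->
    hat_fun_rec n i = hat_fun i.
  move=> n0 im; apply: fuelE => //; exact: leq_ltn_trans im (nsnd_lt n0).
rewrite [LHS]/hat_fun/=; case: (nfst n) lt1 => [//|[//|[|[|t]]]] lt1.
- by rewrite !lt1// ?nfst_le ?nsnd_le.
- by rewrite !lt1// ?nfst_le ?nsnd_le.
- by rewrite !lt1// ?(leq_trans (nfst_le _) (nsnd_le _))
      ?(leq_trans (nsnd_le _) (nsnd_le _)).
Qed.

Lemma range_hat_fun : range hat_fun = hat_class.
Proof.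
apply/seteqP; split=> [_ [n _ <-]|f].
- elim/ltn_ind: n => n IH; rewrite hat_funE/=.
  have lt1 i : (0 < nfst n)%N -> (i <= nsnd n)%N -> hat_class (hat_fun i).
    by move=> n0 im; apply: IH; exact: leq_ltn_trans im (nsnd_lt n0).
  case: (nfst n) lt1 => [|[|[|[|t]]]] lt1; first exact: hat_class1.
  + exact: hat_class_hat.
  + by apply: hat_class_max; apply: lt1; rewrite ?nfst_le ?nsnd_le.
  + by apply: hat_class_min; apply: lt1; rewrite ?nfst_le ?nsnd_le.
  + apply: hat_class_lin; apply: lt1 => //.
    * exact: leq_trans (nfst_le _) (nsnd_le _).
    * exact: leq_trans (nsnd_le _) (nsnd_le _).
- elim=> [|i r [//|n] _|{}f g _ [i _ <-] _ [j _ <-]|{}f g _ [i _ <-] _ [j _ <-]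
         |a b {}f g _ [i _ <-] _ [j _ <-]].
  + by exists (npair 0 0) => //; rewrite hat_funE/= !npairK.
  + have [q <-] := rat_of_nat_surj r.
    by exists (npair 1 (npair i (npair q n))) => //; rewrite hat_funE/= !npairK.
  + by exists (npair 2 (npair i j)) => //; rewrite hat_funE/= !npairK.
  + by exists (npair 3 (npair i j)) => //; rewrite hat_funE/= !npairK.
  + have [[p <-] [q <-]] := (rat_of_nat_surj a, rat_of_nat_surj b).
    exists (npair 4 (npair (npair p q) (npair i j))) => //.
    by rewrite hat_funE/= !npairK.
Qed.

End hat_functions.

Definition computable_kernel {R : realType} {X1 X0 : cmspace R}
    (L : R.-pker (borel X1) ~> (borel X0)) : Prop :=
  computable_map (prod_basis nat_basis (cm_basis X1)) (@real_basis R)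
    (fun ix : nat * X1 => Rintegral (L ix.2) [set: borel X0] (hat_fun ix.1)).

(* Main.v *)
Require Import Defs.
From HB Require Import structures.
From mathcomp Require Import all_boot all_order all_algebra.
From mathcomp Require Import all_classical all_reals all_analysis.
From mathcomp Require Import measurable_realfun giry.
From mathcomp Require Import zify ring lra.
Set Implicit Arguments.
Unset Strict Implicit.
Unset Printing Implicit Defensive.
Import Order.TTheory GRing.Theory Num.Theory.
Import numFieldNormedType.Exports.
Local Open Scope classical_set_scope.
Local Open Scope ring_scope.

(* The map [f mu x = \int t0_(L mu) dL_x] is itself a randomness test on [X1],
   so universality of [t1] gives the constant.  Its integral against [mu] is
   [\int t0_(L mu) d(L mu) <= 1].  For lower semicomputability, measures are
   handled through the facts [mu (U) > b], [U] a finite union of basic balls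
   and [b] rational: hat functions increase to indicators of such [U], so these
   facts are effectively open in [x] for [L_x]; the layer cake formula turns
   them into effectively open conditions on integrals of lower semicomputable
   functions, first for [L mu (U) = \int L_x (U) dmu], then for [f].  The link
   with the Prokhorov metric is that a ball around a finitely supported measure
   is cut out by finitely many such facts, and conversely that [mu (U) > b] is
   certified by small enough balls around rational measures, which are dense. *)

(** * Recursive functions and semidecidable predicates *)

(** The data do not match: [L] is computable through integrals of hat functions, whereas superlevel
    sets of tests are made of Prokhorov balls, whose definition quantifies over all Borel sets.
    Lower bounds on the measures of finite unions of balls bridge the two. They suffice because
    everything is one-sided: a superlevel set of an integral only asks for measures bounded from
    below, and for probability measures the Prokhorov inequality in one direction implies the other.
    Inclusions between neighbourhoods are handled through formal relations ([subball], [sub_weak],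
    [sub_joint]). Being built from strict inequalities between computable quantities, these are
    semidecidable; they imply the true inclusion; and small enough neighbourhoods of a point always
    satisfy them. This is what allows finitely many facts to be replaced by one basic ball. *)

Definition recursive (f : nat -> nat) : Prop :=
  exists c, forall n, prf_eval c n (f n).

Lemma recursive_ext f g : f =1 g -> recursive f -> recursive g.
Proof. by move=> fg [c cf]; exists c => n; rewrite -fg. Qed.

Lemma recursive_comp f g :
  recursive f -> recursive g -> recursive (fun n => f (g n)).
Proof. by move=> [c cf] [e eg]; exists (PComp c e) => n /=; exists (g n). Qed.

Lemma recursive_pair f g :
  recursive f -> recursive g -> recursive (fun n => npair (f n) (g n)).
Proof.
by move=> [c cf] [e eg]; exists (PPair c e) => n /=; exists (f n), (g n).
Qed.

Lemma recursive_nfst : recursive nfst. Proof. by exists PFst. Qed.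
Lemma recursive_nsnd : recursive nsnd. Proof. by exists PSnd. Qed.
Lemma recursive_succ : recursive succn. Proof. by exists PSucc. Qed.

Lemma recursive_id : recursive id.
Proof.
apply: (@recursive_ext (fun n => npair (nfst n) (nsnd n))) nunpairK _.
exact: recursive_pair recursive_nfst recursive_nsnd.
Qed.

Lemma recursive_const k : recursive (fun=> k).
Proof.
elim: k => [|k IH]; first by exists PZero.
exact: recursive_comp recursive_succ IH.
Qed.

(** [PPrec] reads parameter and bound from one packed argument, so the recursion is built for a free
    bound and then composed with [k]. *)
Lemma recursive_nat_rec (a : nat -> nat) (h : nat -> nat -> nat -> nat)
    (k : nat -> nat) :
  recursive a ->
  recursive (fun m => h (nfst m) (nfst (nsnd m)) (nsnd (nsnd m))) ->
  recursive k -> recursive (fun n => nat_rec _ (a n) (h n) (k n)).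
Proof.
move=> [ca Ha] [ch Hh] Hk.
have Hr : recursive (fun m => nat_rec _ (a (nfst m)) (h (nfst m)) (nsnd m)).
  exists (PPrec ca ch) => m /=.
  exists (fun i => nat_rec _ (a (nfst m)) (h (nfst m)) i); split=> //= i _.
  by have := Hh (npair (nfst m) (npair i
    (nat_rec _ (a (nfst m)) (h (nfst m)) i))); rewrite !npairK.
apply: recursive_ext (recursive_comp Hr (recursive_pair recursive_id Hk)) => n.
by rewrite !npairK.
Qed.

Ltac rec_step :=
  lazymatch goal with
  | |- recursive (fun _ => ?k) => exact: (recursive_const k)
  | |- recursive (fun n => n) => exact: recursive_id
  | |- recursive nfst => exact: recursive_nfst
  | |- recursive nsnd => exact: recursive_nsnd
  | |- recursive succn => exact: recursive_succ
  | |- recursive (fun n => npair (@?f n) (@?g n)) =>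
      apply: (@recursive_pair f g)
  | |- recursive (fun n => nat_rec _ (@?a n) (@?h n) (@?k n)) =>
      apply: (@recursive_nat_rec a h k)
  | |- recursive (fun n => nfst (@?f n)) =>
      apply: (@recursive_comp nfst f) recursive_nfst _
  | |- recursive (fun n => nsnd (@?f n)) =>
      apply: (@recursive_comp nsnd f) recursive_nsnd _
  | |- recursive (fun n => (@?f n).+1) =>
      apply: (@recursive_comp succn f) recursive_succ _
  | H : recursive ?f |- recursive ?f => exact: H
  | H : recursive ?f |- recursive (fun n => ?f (@?g n)) =>
      apply: (@recursive_comp f g H)
  end.

Lemma recursive_comp2 (F : nat -> nat -> nat) f g :
  recursive (fun m => F (nfst m) (nsnd m)) ->
  recursive f -> recursive g -> recursive (fun n => F (f n) (g n)).
Proof.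
move=> HF Hf Hg.
apply: recursive_ext (recursive_comp HF (recursive_pair Hf Hg)) => n.
by rewrite !npairK.
Qed.

Lemma recursive_pred : recursive predn.
Proof.
apply: (@recursive_ext (fun n => nat_rec _ 0%N (fun i _ => i) n)).
  by case.
apply: (@recursive_nat_rec (fun=> 0%N) (fun _ i _ => i) id).
- exact: recursive_const.
- exact: recursive_comp recursive_nfst recursive_nsnd.
- exact: recursive_id.
Qed.

Lemma recursive_add f g :
  recursive f -> recursive g -> recursive (fun n => f n + g n)%N.
Proof.
move=> Hf Hg.
apply: (@recursive_ext
  (fun n => nat_rec _ (f n) (fun _ s => s.+1) (g n))) => [n|].
  by elim: (g n) => [|i /= ->]; rewrite ?addn0 ?addnS.
apply: (@recursive_nat_rec f (fun _ _ s => s.+1) g) => //.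
by do ?rec_step.
Qed.

Lemma recursive_sub f g :
  recursive f -> recursive g -> recursive (fun n => f n - g n)%N.
Proof.
move=> Hf Hg.
apply: (@recursive_ext
  (fun n => nat_rec _ (f n) (fun _ s => s.-1) (g n))) => [n|].
  by elim: (g n) => [|i /= ->]; rewrite ?subn0 ?subnS.
apply: (@recursive_nat_rec f (fun _ _ s => s.-1) g) => //.
by apply: recursive_comp recursive_pred _; do ?rec_step.
Qed.

Lemma recursive_mul f g :
  recursive f -> recursive g -> recursive (fun n => f n * g n)%N.
Proof.
move=> Hf Hg.
apply: (@recursive_ext
  (fun n => nat_rec _ 0%N (fun _ s => s + f n)%N (g n))) => [n|].
  by elim: (g n) => [|i /= ->]; rewrite ?muln0 ?mulnSr.
apply: (@recursive_nat_rec (fun=> 0%N) (fun n _ s => s + f n)%N g) => //.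
- exact: recursive_const.
- apply: recursive_add; first by do ?rec_step.
  exact: recursive_comp Hf recursive_nfst.
Qed.

Definition decidable_pred (b : nat -> bool) : Prop :=
  recursive (fun n => b n : nat).

Lemma decidable_ext b b' : b =1 b' -> decidable_pred b -> decidable_pred b'.
Proof. by move=> bb'; apply: recursive_ext => n; rewrite bb'. Qed.

Lemma decidable_comp b f :
  decidable_pred b -> recursive f -> decidable_pred (fun n => b (f n)).
Proof. exact: recursive_comp. Qed.

Lemma decidable_neg b :
  decidable_pred b -> decidable_pred (fun n => ~~ b n).
Proof.
move=> Hb; apply: recursive_ext (recursive_sub (recursive_const 1) Hb) => n.
by case: (b n).
Qed.

Lemma decidable_and b b' : decidable_pred b -> decidable_pred b' ->
  decidable_pred (fun n => b n && b' n).
Proof.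
move=> Hb Hb'; apply: recursive_ext (recursive_mul Hb Hb') => n.
by case: (b n); case: (b' n).
Qed.

Lemma decidable_or b b' : decidable_pred b -> decidable_pred b' ->
  decidable_pred (fun n => b n || b' n).
Proof.
move=> Hb Hb'.
apply: decidable_ext
  (decidable_neg (decidable_and (decidable_neg Hb) (decidable_neg Hb'))) => n.
by rewrite negb_and !negbK.
Qed.

Lemma decidable_eq0 f : recursive f -> decidable_pred (fun n => f n == 0%N).
Proof.
move=> Hf; apply: recursive_ext (recursive_sub (recursive_const 1) Hf) => n.
by case: (f n) => [|k]; rewrite ?subn0// subn_eq0.
Qed.

Lemma decidable_leq f g : recursive f -> recursive g ->
  decidable_pred (fun n => f n <= g n)%N.
Proof. by move=> Hf Hg; exact: (decidable_eq0 (recursive_sub Hf Hg)). Qed.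

Lemma decidable_ltn f g : recursive f -> recursive g ->
  decidable_pred (fun n => f n < g n)%N.
Proof.
by move=> Hf; apply: decidable_leq; exact: recursive_comp recursive_succ Hf.
Qed.

Lemma decidable_eqn f g : recursive f -> recursive g ->
  decidable_pred (fun n => f n == g n)%N.
Proof.
move=> Hf Hg.
apply: decidable_ext
  (decidable_and (decidable_leq Hf Hg) (decidable_leq Hg Hf)) => n.
by rewrite eqn_leq.
Qed.

Lemma recursive_if b f g : decidable_pred b -> recursive f -> recursive g ->
  recursive (fun n => if b n then f n else g n).
Proof.
move=> Hb Hf Hg.
apply: (@recursive_ext (fun n => b n * f n + ~~ b n * g n)%N) => [n|].
  by case: (b n); rewrite !(mul0n, mul1n, addn0).
by apply: recursive_add; apply: recursive_mul => //; exact: decidable_neg.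
Qed.

Lemma recursive_sum (F : nat -> nat -> nat) k :
  recursive (fun m => F (nfst m) (nsnd m)) -> recursive k ->
  recursive (fun n => \sum_(i < k n) F n i)%N.
Proof.
move=> HF Hk; apply: (@recursive_ext
  (fun n => nat_rec _ 0%N (fun i s => s + F n i)%N (k n))) => [n|].
  by elim: (k n) => [|i /= ->]; rewrite ?big_ord0// big_ord_recr.
apply: (@recursive_nat_rec (fun=> 0%N) (fun n i s => s + F n i)%N k) => //.
- exact: recursive_const.
- apply: recursive_add; first by do ?rec_step.
  by apply: (recursive_comp2 HF); do ?rec_step.
Qed.

(** A bounded search is a finite sum of truth values tested against 0. *)
Lemma decidable_exists_lt (b : nat -> nat -> bool) k :
  decidable_pred (fun m => b (nfst m) (nsnd m)) -> recursive k ->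
  decidable_pred (fun n => [exists i : 'I_(k n), b n i]).
Proof.
move=> Hb Hk.
apply: decidable_ext
  (decidable_neg (decidable_eq0
    (recursive_sum (F := fun n i => b n i : nat) Hb Hk))) => n.
rewrite sum_nat_eq0 negb_forall; apply: eq_existsb => i /=.
by case: (b n i).
Qed.

Lemma decidable_forall_lt (b : nat -> nat -> bool) k :
  decidable_pred (fun m => b (nfst m) (nsnd m)) -> recursive k ->
  decidable_pred (fun n => [forall i : 'I_(k n), b n i]).
Proof.
move=> Hb Hk.
apply: decidable_ext
  (decidable_neg (decidable_exists_lt (b := fun n i => ~~ b n i)
    (decidable_neg Hb) Hk)) => n.
by rewrite negb_exists; apply: eq_forallb => i; rewrite negbK.
Qed.

(** Projections of decidable predicates: logical closure properties are direct here, while [re_set]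
    speaks of domains of programs. The two agree by [re_set_semidec]. *)
Definition semidec (A : nat -> Prop) : Prop :=
  exists2 b : nat -> bool, decidable_pred b &
    forall n, A n <-> exists w, b (npair n w).

Lemma semidec_ext A B : (forall n, A n <-> B n) -> semidec A -> semidec B.
Proof. by move=> AB [b Hb Ab]; exists b => // n; rewrite -AB. Qed.

Lemma decidable_semidec b : decidable_pred b -> semidec (fun n => b n).
Proof.
move=> Hb; exists (fun m => b (nfst m)).
  exact: decidable_comp Hb recursive_nfst.
by move=> n; split=> [bn|[w]]; first exists 0%N; rewrite npairK.
Qed.

Lemma semidec_comp A f :
  semidec A -> recursive f -> semidec (fun n => A (f n)).
Proof.
move=> [b Hb Ab] Hf; exists (fun m => b (npair (f (nfst m)) (nsnd m))).
  apply: decidable_comp Hb _; apply: recursive_pair; last by do ?rec_step.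
  exact: recursive_comp Hf recursive_nfst.
by move=> n; rewrite Ab; split=> -[w bw]; exists w; move: bw; rewrite !npairK.
Qed.

Lemma semidec_comp2 (A : nat -> nat -> Prop) f g :
  semidec (fun m => A (nfst m) (nsnd m)) ->
  recursive f -> recursive g -> semidec (fun n => A (f n) (g n)).
Proof.
move=> HA Hf Hg.
apply: semidec_ext (semidec_comp HA (recursive_pair Hf Hg)) => n.
by rewrite !npairK.
Qed.

Lemma semidec_ex (A : nat -> nat -> Prop) :
  semidec (fun m => A (nfst m) (nsnd m)) -> semidec (fun n => exists k, A n k).
Proof.
move=> [b Hb Ab].
exists (fun m => b (npair (npair (nfst m) (nfst (nsnd m))) (nsnd (nsnd m)))).
  by apply: decidable_comp Hb _; do ?rec_step.
move=> n; split=> [[k]|[w]].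
  have := Ab (npair n k); rewrite !npairK => -> [w bw].
  by exists (npair k w); rewrite !npairK.
rewrite !npairK => bw; exists (nfst w).
by have := Ab (npair n (nfst w)); rewrite !npairK => ->; exists (nsnd w).
Qed.

Lemma semidec_and A B :
  semidec A -> semidec B -> semidec (fun n => A n /\ B n).
Proof.
move=> [b Hb Ab] [b' Hb' Bb].
exists (fun m => b (npair (nfst m) (nfst (nsnd m))) &&
                 b' (npair (nfst m) (nsnd (nsnd m)))).
  by apply: decidable_and;
    [apply: decidable_comp Hb _|apply: decidable_comp Hb' _]; do ?rec_step.
move=> n; rewrite Ab Bb; split=> [[[w bw] [w' bw']]|[w]].
  by exists (npair w w'); rewrite !npairK bw.
by rewrite !npairK => /andP[bw bw']; split; [exists (nfst w)|exists (nsnd w)].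
Qed.

(** Finitely many witnesses have a common strict bound [w]; given [w], looking for a witness below
    it for each [i] is a decidable bounded search. *)
Lemma semidec_forall_lt (A : nat -> nat -> Prop) k :
  semidec (fun m => A (nfst m) (nsnd m)) -> recursive k ->
  semidec (fun n => forall i, (i < k n)%N -> A n i).
Proof.
move=> [b Hb Ab] Hk.
pose b' n i := [exists w : 'I_(nsnd n), b (npair (npair (nfst n) i) w)].
exists (fun m => [forall i : 'I_(k (nfst m)), b' m i]).
  apply: decidable_forall_lt; last exact: recursive_comp Hk recursive_nfst.
  apply: (@decidable_exists_lt
    (fun m w => b (npair (npair (nfst (nfst m)) (nsnd m)) w))).
  - by apply: decidable_comp Hb _; do ?rec_step.
  - by do ?rec_step.
move=> n; split=> [An|[w] + i ltik].
  suff [w bw] : exists w, forall i, (i < k n)%N -> exists2 v,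
      (v < w)%N & b (npair (npair n i) v).
    exists w; apply/forallP => i; apply/existsP; rewrite !npairK in i *.
    by have [v vw bv] := bw i (ltn_ord i); exists (Ordinal vw).
  elim: (k n) An => [|j IHj] An; first by exists 0%N.
  have [|w bw] := IHj; first by move=> i ij; apply: An; rewrite ltnS ltnW.
  have := Ab (npair n j); rewrite !npairK => -[+ _].
  move=> /(_ (An j (ltnSn j)))[v bv].
  exists (maxn w v.+1) => i; rewrite ltnS leq_eqVlt.
  move=> /predU1P[->|/bw[u uw bu]].
    by exists v => //; rewrite leq_max ltnSn orbT.
  by exists u => //; rewrite leq_max uw.
rewrite npairK => /forallP/(_ (Ordinal ltik))/existsP[v].
rewrite !npairK/= => bv.
by have := Ab (npair n i); rewrite !npairK => ->; exists v.
Qed.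

Lemma semidec_or A B :
  semidec A -> semidec B -> semidec (fun n => A n \/ B n).
Proof.
move=> [b Hb Ab] [b' Hb' Bb]; exists (fun m => b m || b' m).
  exact: decidable_or.
move=> n; rewrite Ab Bb; split=> [[[w bw]|[w bw]]|[w /orP[bw|bw]]].
- by exists w; rewrite bw.
- by exists w; rewrite bw orbT.
- by left; exists w.
- by right; exists w.
Qed.

(** * Coded lists *)

Definition lcons (a l : nat) : nat := (npair a l).+1.
Definition nnth (l i : nat) : nat := nth 0%N (seq_of_nat l) i.
Definition nsize (l : nat) : nat := size (seq_of_nat l).
Definition nmem (l i : nat) : bool := i \in seq_of_nat l.

Lemma seq_of_nat_cons a l : seq_of_nat (lcons a l) = a :: seq_of_nat l.
Proof. by rewrite seq_of_natS !npairK. Qed.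

(** A total tail on codes. Iterating it by primitive recursion gives access to entries and length
    without formalising [seq_of_nat] itself as a recursive function. *)
Definition ntail l := if l == 0%N then 0%N else nsnd l.-1.

Lemma iter_ntail i l : seq_of_nat (iter i ntail l) = drop i (seq_of_nat l).
Proof.
elim: i l => [|i IHi] l; first by rewrite drop0.
rewrite iterSr IHi /ntail; case: l => [|l]; first by rewrite seq_of_nat0.
by rewrite seq_of_natS.
Qed.

Lemma recursive_iter_ntail f g :
  recursive f -> recursive g -> recursive (fun n => iter (f n) ntail (g n)).
Proof.
move=> Hf Hg; apply: (@recursive_ext
  (fun n => nat_rec _ (g n) (fun _ s => ntail s) (f n))) => [n|].
  by elim: (f n) => [//|i /= ->].
apply: (@recursive_nat_rec g (fun _ _ s => ntail s)) => //.
apply: recursive_if.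
- by apply: decidable_eq0; do ?rec_step.
- exact: recursive_const.
- rec_step; apply: recursive_comp recursive_pred _; by do ?rec_step.
Qed.

Lemma recursive_nnth f g :
  recursive f -> recursive g -> recursive (fun n => nnth (f n) (g n)).
Proof.
move=> Hf Hg.
apply: (@recursive_ext (fun n => nfst (iter (g n) ntail (f n)).-1)) => [n|].
  rewrite /nnth -[X in nth _ _ X]addn0 -nth_drop -iter_ntail.
  case: (iter _ _ _) => [|m]; last by rewrite seq_of_natS.
  by rewrite seq_of_nat0/=.
rec_step; apply: recursive_comp recursive_pred _.
exact: recursive_iter_ntail.
Qed.

Lemma nsize_le l : (nsize l <= l)%N.
Proof.
elim/ltn_ind: l => -[//|l] IH; rewrite /nsize seq_of_natS/= ltnS.
by apply: (leq_trans (IH _ _)); rewrite ?ltnS nsnd_le.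
Qed.

(** The length is the number of nonempty iterated tails: 0 is the only code of the empty list, and
    by [nsize_le] the code itself bounds how many tails to inspect. *)
Lemma recursive_nsize f : recursive f -> recursive (fun n => nsize (f n)).
Proof.
move=> Hf; apply: (@recursive_ext
  (fun n => \sum_(i < f n) (iter i ntail (f n) != 0%N))%N) => [n|].
  transitivity (\sum_(i < f n) (i < nsize (f n)))%N.
    apply: eq_bigr => i _; congr nat_of_bool.
    rewrite -(subn_gt0 i) /nsize -size_drop -iter_ntail.
    by case: (iter _ _ _) => [|m]; rewrite ?seq_of_nat0// seq_of_natS.
  have := nsize_le (f n); move: (nsize _) => s sf.
  rewrite -(subnK sf) addnC big_split_ord/=.
  rewrite (eq_bigr (fun=> 1%N)) => [|i _]; last by rewrite ltn_ord.
  rewrite sum1_card card_ord big1 ?addn0// => i _.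
  by rewrite ltnNge leq_addr.
apply: (recursive_sum
  (F := fun n i => (iter i ntail (f n) != 0%N) : nat)) => //.
apply: decidable_neg; apply: decidable_eq0.
apply: recursive_iter_ntail; do ?rec_step.
Qed.

Lemma decidable_nmem f g : recursive f -> recursive g ->
  decidable_pred (fun n => nmem (f n) (g n)).
Proof.
move=> Hf Hg; apply: (@decidable_ext
  (fun n => [exists i : 'I_(nsize (f n)), nnth (f n) i == g n])) => [n|].
  apply/existsP/(nthP 0%N) => [[i /eqP <-]|[i lti <-]]; first by exists i.
  by exists (Ordinal lti).
apply: (@decidable_exists_lt (fun n i => nnth (f n) i == g n)).
  by apply: decidable_eqn; first apply: recursive_nnth; do ?rec_step.
exact: recursive_nsize.
Qed.

Ltac rec := repeat first [rec_step | lazymatch goal with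
  | |- recursive (fun n => (@?f n + @?g n)%N) => apply: (@recursive_add f g)
  | |- recursive (fun n => (@?f n - @?g n)%N) => apply: (@recursive_sub f g)
  | |- recursive (fun n => (@?f n * @?g n)%N) => apply: (@recursive_mul f g)
  | |- recursive (fun n => nnth (@?f n) (@?g n)) => apply: (@recursive_nnth f g)
  | |- recursive (fun n => nsize (@?f n)) => apply: (@recursive_nsize f)
  | |- recursive (fun n => (@?f n).-1) =>
      apply: (@recursive_comp predn f) recursive_pred _
  end].

Definition nsub (l l' : nat) : bool := all (nmem l') (seq_of_nat l).

Lemma decidable_nsub f g : recursive f -> recursive g ->
  decidable_pred (fun n => nsub (f n) (g n)).
Proof.
move=> Hf Hg; apply: (@decidable_ext (fun n =>
  [forall i : 'I_(nsize (f n)), nmem (g n) (nnth (f n) i)])) => [n|].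
  apply/forallP/(all_nthP 0%N) => [H i lti|H i]; last exact: H.
  exact: (H (Ordinal lti)).
apply: (@decidable_forall_lt (fun n i => nmem (g n) (nnth (f n) i))).
  by apply: decidable_nmem; last apply: recursive_nnth; do ?rec_step.
exact: recursive_nsize.
Qed.

Lemma semidec_forall_mem (A : nat -> nat -> Prop) f :
  semidec (fun m => A (nfst m) (nsnd m)) -> recursive f ->
  semidec (fun n => forall i, i \in seq_of_nat (f n) -> A n i).
Proof.
move=> HA Hf; apply: (@semidec_ext
  (fun n => forall i, (i < nsize (f n))%N -> A n (nnth (f n) i))) => [n|].
  split=> [An i /(nthP 0%N)[j ltj <-]|An i lti]; first exact: An.
  by apply: An; exact: mem_nth.
apply: (@semidec_forall_lt (fun n i => A n (nnth (f n) i))).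
  by apply: (semidec_comp2 HA); last apply: recursive_nnth; do ?rec_step.
exact: recursive_nsize.
Qed.

(** Induction on the program. For [PPrec] the sequence of intermediate values is finite and becomes
    a coded list, so it can be searched for; for [PMu] the earlier arguments form a bounded
    quantifier. *)
Lemma semidec_prf_eval c :
  semidec (fun p => prf_eval c (nfst p) (nsnd p)).
Proof.
have eqS f g : recursive f -> recursive g -> semidec (fun n => f n = g n).
  move=> Hf Hg; apply: semidec_ext (decidable_semidec (decidable_eqn Hf Hg)).
  by move=> n; split=> /eqP.
elim: c => [||||f IHf g IHg|f IHf g IHg|f IHf g IHg|f IHf] /=.
1-4: by apply: eqS; do ?rec_step.
- apply: (@semidec_ext (fun p => exists a b, prf_eval f (nfst p) a /\
    (prf_eval g (nfst p) b /\ nsnd p = npair a b))) => [p|].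
    by split=> -[a [b]] => [[fa [gb ->]]|[fa gb ->]]; exists a, b.
  apply: (@semidec_ex (fun p a => exists b, prf_eval f (nfst p) a /\
    (prf_eval g (nfst p) b /\ nsnd p = npair a b))).
  apply: (@semidec_ex (fun p b => prf_eval f (nfst (nfst p)) (nsnd p) /\
    (prf_eval g (nfst (nfst p)) b /\ nsnd (nfst p) = npair (nsnd p) b))).
  apply: semidec_and; first by apply: (semidec_comp2 IHf); do ?rec_step.
  apply: semidec_and; first by apply: (semidec_comp2 IHg); do ?rec_step.
  by apply: eqS; do ?rec_step.
- apply: (@semidec_ext (fun p => exists k, prf_eval g (nfst p) k /\
    prf_eval f k (nsnd p))) => [p|].
    by split=> [[k []]|[k]] *; exists k.
  apply: (@semidec_ex (fun p k => prf_eval g (nfst p) k /\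
    prf_eval f k (nsnd p))).
  apply: semidec_and; first by apply: (semidec_comp2 IHg); do ?rec_step.
  by apply: (semidec_comp2 IHf); do ?rec_step.
- pose step p s i := prf_eval g
    (npair (nfst (nfst p)) (npair i (nnth s i))) (nnth s i.+1).
  apply: (@semidec_ext (fun p => exists s,
      prf_eval f (nfst (nfst p)) (nnth s 0) /\
      ((forall i, (i < nsnd (nfst p))%N -> step p s i) /\
       nsnd p = nnth s (nsnd (nfst p))))) => [p|].
    split=> [[s [s0 [sS se]]]|[s [s0 sS se]]]; first by exists (nnth s).
    have [c cE] := seq_of_nat_surj (mkseq s (nsnd (nfst p)).+1).
    have cs i : (i <= nsnd (nfst p))%N -> nnth c i = s i.
      by move=> lei; rewrite /nnth cE nth_mkseq.
    exists c; rewrite cs//; split=> //; split; last by rewrite cs.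
    move=> i lti; rewrite /step (cs i (ltnW lti)) (cs i.+1 lti); exact: sS.
  apply: (@semidec_ex (fun p s => prf_eval f (nfst (nfst p)) (nnth s 0) /\
      ((forall i, (i < nsnd (nfst p))%N -> step p s i) /\
       nsnd p = nnth s (nsnd (nfst p))))).
  apply: semidec_and.
    apply: (semidec_comp2 IHf); first by do ?rec_step.
    by apply: recursive_nnth; do ?rec_step.
  apply: semidec_and; last first.
    by apply: eqS; last apply: recursive_nnth; do ?rec_step.
  apply: (@semidec_forall_lt (fun m i => step (nfst m) (nsnd m) i)); last first.
    by do ?rec_step.
  apply: (semidec_comp2 IHg); do ?rec_step.
    by apply: recursive_nnth; do ?rec_step.
  by apply: recursive_nnth; do ?rec_step.
- apply: semidec_and.
    by apply: (semidec_comp2 IHf); do ?rec_step.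
  apply: (@semidec_forall_lt (fun p i =>
    exists v, prf_eval f (npair (nfst p) i) v.+1)); last by do ?rec_step.
  apply: (@semidec_ex (fun m v =>
    prf_eval f (npair (nfst (nfst m)) (nsnd m)) v.+1)).
  by apply: (semidec_comp2 IHf); do ?rec_step.
Qed.

Lemma re_set_semidec (A : set nat) : re_set A <-> semidec A.
Proof.
split=> [[c ->]|[b Hb Ab]].
  exact: (@semidec_ex (fun n m => prf_eval c n m) (semidec_prf_eval c)).
(* Minimisation looks for the value 0, so it is applied to the negation of [b]: it stops at the
   least witness, and yields 1 before it. *)
have [c cE] := decidable_neg Hb; exists (PMu c); apply/seteqP.
split=> n; rewrite Ab /=; last first.
  move=> [m [cm _]]; exists m; have := prf_eval_fun cm (cE _).
  by case: (b _).
move=> exb; have [w bw wmin] := ex_minnP exb; exists w; split.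
  by have := cE (npair n w); rewrite bw.
move=> i ltiw; exists 0%N; have := cE (npair n i).
by case: (boolP (b _)) => // /wmin; rewrite leqNgt ltiw.
Qed.

(** * Recursive rational-valued functions *)

(** Codes of rationals are not unique, so only the value of the code is prescribed. *)
Definition ratrec (f : nat -> rat) : Prop :=
  exists2 g, recursive g & forall n, f n = rat_of_nat (g n).

Lemma ratrec_comp f g : ratrec f -> recursive g -> ratrec (fun n => f (g n)).
Proof.
by move=> [h Hh fE] Hg; exists (fun n => h (g n)) => //; exact: recursive_comp.
Qed.

Lemma ratrec_code f : recursive f -> ratrec (fun n => rat_of_nat (f n)).
Proof. by exists f. Qed.

Lemma ratrec_nat f : recursive f -> ratrec (fun n => (f n)%:R).
Proof.
move=> Hf; exists (fun n => npair (f n) (npair 0 0)); first by do ?rec_step.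
by move=> n; rewrite /rat_of_nat !npairK subr0 divr1.
Qed.

Lemma ratrec_add f g : ratrec f -> ratrec g -> ratrec (fun n => f n + g n).
Proof.
move=> [cf Hf fE] [cg Hg gE].
pose a := fun n => nfst (cf n); pose b := fun n => nfst (nsnd (cf n)).
pose c := fun n => nsnd (nsnd (cf n)); pose a' := fun n => nfst (cg n).
pose b' := fun n => nfst (nsnd (cg n)); pose c' := fun n => nsnd (nsnd (cg n)).
(* A code stores its denominator minus one, hence the predecessor. *)
exists (fun n => npair (a n * (c' n).+1 + a' n * (c n).+1)
  (npair (b n * (c' n).+1 + b' n * (c n).+1) ((c n).+1 * (c' n).+1).-1)).
  by rewrite /a /b /c /a' /b' /c'; rec.
move=> n; rewrite fE gE /rat_of_nat !npairK prednK ?muln_gt0// -/(a n) -/(b n).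
rewrite -/(c n) -/(a' n) -/(b' n) -/(c' n).
have : (c n).+1%:R != 0 :> rat by rewrite pnatr_eq0.
have : (c' n).+1%:R != 0 :> rat by rewrite pnatr_eq0.
move: (c n).+1 (c' n).+1 => u v v0 u0.
by rewrite !natrD !natrM; field; rewrite u0 v0.
Qed.

Lemma ratrec_opp f : ratrec f -> ratrec (fun n => - f n).
Proof.
move=> [cf Hf fE].
exists (fun n => npair (nfst (nsnd (cf n)))
  (npair (nfst (cf n)) (nsnd (nsnd (cf n))))); first by do ?rec_step.
by move=> n; rewrite fE /rat_of_nat !npairK -mulNr opprB.
Qed.

Lemma ratrec_sub f g : ratrec f -> ratrec g -> ratrec (fun n => f n - g n).
Proof. by move=> Hf Hg; apply: ratrec_add => //; exact: ratrec_opp. Qed.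

Lemma ratrec_mul f g : ratrec f -> ratrec g -> ratrec (fun n => f n * g n).
Proof.
move=> [cf Hf fE] [cg Hg gE].
pose a := fun n => nfst (cf n); pose b := fun n => nfst (nsnd (cf n)).
pose c := fun n => nsnd (nsnd (cf n)); pose a' := fun n => nfst (cg n).
pose b' := fun n => nfst (nsnd (cg n)); pose c' := fun n => nsnd (nsnd (cg n)).
exists (fun n => npair (a n * a' n + b n * b' n)
  (npair (a n * b' n + b n * a' n) ((c n).+1 * (c' n).+1).-1)).
  by rewrite /a /b /c /a' /b' /c'; rec.
move=> n; rewrite fE gE /rat_of_nat !npairK prednK ?muln_gt0// -/(a n) -/(b n).
rewrite -/(c n) -/(a' n) -/(b' n) -/(c' n).
have : (c n).+1%:R != 0 :> rat by rewrite pnatr_eq0.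
have : (c' n).+1%:R != 0 :> rat by rewrite pnatr_eq0.
move: (c n).+1 (c' n).+1 => u v v0 u0.
by rewrite !natrD !natrM; field; rewrite u0 v0.
Qed.

Lemma ratrec_invS f : recursive f -> ratrec (fun n => (f n).+1%:R^-1).
Proof.
move=> Hf; exists (fun n => npair 1 (npair 0 (f n))); first by do ?rec_step.
by move=> n; rewrite /rat_of_nat !npairK subr0 mul1r.
Qed.

Lemma ratrec_pcode f : recursive f -> ratrec (fun n => prat_of_nat (f n)).
Proof.
move=> Hf; apply: ratrec_mul; last by apply: ratrec_invS; do ?rec_step.
by apply: ratrec_nat; do ?rec_step.
Qed.

Lemma ratrec_sum (F : nat -> nat -> rat) k :
  ratrec (fun m => F (nfst m) (nsnd m)) -> recursive k ->
  ratrec (fun n => \sum_(i < k n) F n i).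
Proof.
move=> HF Hk.
have [h Hh hE] := ratrec_add (ratrec_code recursive_nfst)
  (ratrec_comp HF recursive_nsnd).
exists (fun n => nat_rec _ (npair 0 (npair 0 0))
  (fun i s => h (npair s (npair n i))) (k n)).
  apply: (@recursive_nat_rec (fun=> _) (fun n i s => h (npair s (npair n i))));
  do ?rec_step.
move=> n; elim: (k n) => [|j IHj].
  by rewrite big_ord0 /rat_of_nat /= !npairK subr0 mul0r.
by rewrite big_ord_recr/= -hE !npairK IHj.
Qed.

(** Coded denominators are positive, so the sign of a difference is read off its numerator. *)
Lemma decidable_ltr f g : ratrec f -> ratrec g ->
  decidable_pred (fun n => f n < g n).
Proof.
move=> Hf Hg; have [h Hh hE] := ratrec_sub Hg Hf.
apply: (@decidable_ext (fun n => nfst (nsnd (h n)) < nfst (h n))%N) => [n|].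
  rewrite -[RHS]subr_gt0 hE /rat_of_nat pmulr_lgt0 ?invr_gt0 ?ltr0n//.
  by rewrite subr_gt0 ltr_nat.
by apply: decidable_ltn; do ?rec_step.
Qed.

Lemma decidable_ler f g : ratrec f -> ratrec g ->
  decidable_pred (fun n => f n <= g n).
Proof.
move=> Hf Hg; apply: decidable_ext (decidable_neg (decidable_ltr Hg Hf)) => n.
by rewrite -leNgt.
Qed.

Lemma ratrec_exp2V f : recursive f -> ratrec (fun n => 2 ^- (f n)).
Proof.
move=> Hf; have [h Hh hE] :=
  ratrec_mul (ratrec_code recursive_id) (ratrec_invS (recursive_const 1)).
exists (fun n => nat_rec _ (npair 1 (npair 0 0)) (fun _ s => h s) (f n)).
  by apply: (@recursive_nat_rec (fun=> _) (fun _ _ s => h s)); do ?rec_step.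
move=> n; elim: (f n) => [|j IHj].
  by rewrite expr0 invr1 /rat_of_nat /= !npairK subr0 divr1.
by rewrite /= -hE -IHj exprSr invfM.
Qed.

(** * Effectively open families of sets *)

Definition basic_open {Z} (S : nat -> set Z) (l : nat) : set Z :=
  [set z | forall i, i \in seq_of_nat l -> S i z].

(* [P z n] holds iff finitely many facts [S i z], found by a semidecision
   procedure that does not see [z], certify it. *)
Definition eff_open {Z} (S : nat -> set Z) (P : Z -> nat -> Prop) : Prop :=
  exists2 W : nat -> Prop, semidec W &
    forall z n, P z n <-> exists2 l, W (npair l n) & basic_open S l z.

Section eff_open.
Context {Z : Type} (S : nat -> set Z).
Implicit Types P : Z -> nat -> Prop.

Lemma eff_open_ext P Q : (forall z n, P z n <-> Q z n) ->
  eff_open S P -> eff_open S Q.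
Proof. by move=> PQ [W HW WP]; exists W => // z n; rewrite -PQ. Qed.

(** Closing the certificates under adding facts lets one concatenated list serve several
    certificates at once, as conjunctions and bounded quantifiers require. *)
Lemma eff_open_monotone P : eff_open S P ->
  exists W : nat -> Prop, [/\ semidec W,
    forall l l' n, {subset seq_of_nat l <= seq_of_nat l'} ->
      W (npair l n) -> W (npair l' n) &
    forall z n, P z n <-> exists2 l, W (npair l n) & basic_open S l z].
Proof.
move=> [W HW WP].
exists (fun m => exists k, nsub k (nfst m) /\ W (npair k (nsnd m))); split.
- apply: (@semidec_ex (fun m k => nsub k (nfst m) /\ W (npair k (nsnd m)))).
  apply: semidec_and.
    by apply/decidable_semidec/decidable_nsub; rec.
  by apply: (semidec_comp HW); rec.
- move=> l l' n ll' [k []]; rewrite !npairK => kl Wk; exists k.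
  by split=> //; apply: sub_all kl => i; exact: ll'.
- move=> z n; rewrite WP; split=> [[l Wl Sl]|[l [k []]]].
    exists l => //; exists l; rewrite /= !npairK; split=> //.
    by apply/allP => i.
  by rewrite !npairK => /allP kl Wk Sl; exists k => // i /kl /Sl.
Qed.

Lemma eff_open_semidec (A : nat -> Prop) : semidec A ->
  eff_open S (fun _ n => A n).
Proof.
move=> HA; exists (fun m => A (nsnd m)).
  by apply: (semidec_comp HA); rec.
move=> z n; split=> [An|[l]]; last by rewrite npairK.
by exists 0%N; rewrite ?npairK// => i; rewrite seq_of_nat0.
Qed.

Lemma eff_open_subbasis f : recursive f -> eff_open S (fun z n => S (f n) z).
Proof.
move=> Hf; exists (fun m => nfst m == lcons (f (nsnd m)) 0).
  by apply/decidable_semidec/decidable_eqn; rewrite /lcons; rec.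
move=> z n; split=> [Sz|[l]].
  exists (lcons (f n) 0); rewrite ?npairK// => i.
  by rewrite seq_of_nat_cons seq_of_nat0 inE => /eqP ->.
rewrite !npairK => /eqP -> /(_ (f n)); apply.
by rewrite seq_of_nat_cons mem_head.
Qed.

Lemma eff_open_comp P f : eff_open S P -> recursive f ->
  eff_open S (fun z n => P z (f n)).
Proof.
move=> [W HW WP] Hf; exists (fun m => W (npair (nfst m) (f (nsnd m)))).
  by apply: (semidec_comp HW); rec.
by move=> z n; rewrite WP; split=> -[l Wl Sl]; exists l => //; move: Wl;
  rewrite !npairK.
Qed.

Lemma eff_open_comp2 (P : Z -> nat -> nat -> Prop) f g :
  eff_open S (fun z m => P z (nfst m) (nsnd m)) ->
  recursive f -> recursive g -> eff_open S (fun z n => P z (f n) (g n)).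
Proof.
move=> HP Hf Hg.
apply: eff_open_ext (eff_open_comp HP (recursive_pair Hf Hg)) => z n.
by rewrite !npairK.
Qed.

Lemma eff_open_and P Q : eff_open S P -> eff_open S Q ->
  eff_open S (fun z n => P z n /\ Q z n).
Proof.
move=> /eff_open_monotone[W [HW Wmon WP]] /eff_open_monotone[V [HV Vmon VQ]].
exists (fun m => W m /\ V m); first exact: semidec_and.
move=> z n; rewrite WP VQ; split; last first.
  by move=> [l [Wl Vl] Sl]; split; exists l.
move=> [[l Wl Sl] [k Vk Sk]].
have [j jE] := seq_of_nat_surj (seq_of_nat l ++ seq_of_nat k).
exists j.
  by split; [apply: Wmon Wl|apply: Vmon Vk] => i il;
    rewrite jE mem_cat il ?orbT.
by move=> i; rewrite jE mem_cat => /orP[/Sl|/Sk].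
Qed.

Lemma eff_open_ex (P : Z -> nat -> nat -> Prop) :
  eff_open S (fun z m => P z (nfst m) (nsnd m)) ->
  eff_open S (fun z n => exists k, P z n k).
Proof.
move=> [W HW WP].
exists (fun m => exists k, W (npair (nfst m) (npair (nsnd m) k))).
  apply: (@semidec_ex (fun m k => W (npair (nfst m) (npair (nsnd m) k)))).
  by apply: (semidec_comp HW); rec.
move=> z n; split=> [[k Pk]|[l [k]]].
  have := WP z (npair n k); rewrite !npairK => -[/(_ Pk)[l Wl Sl] _].
  by exists l => //; exists k; rewrite !npairK.
rewrite !npairK => Wl Sl; exists k.
by have := WP z (npair n k); rewrite !npairK => ->; exists l.
Qed.

Lemma eff_open_forall_lt (P : Z -> nat -> nat -> Prop) k :
  eff_open S (fun z m => P z (nfst m) (nsnd m)) -> recursive k ->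
  eff_open S (fun z n => forall i, (i < k n)%N -> P z n i).
Proof.
move=> /eff_open_monotone[W [HW Wmon WP]] Hk.
exists (fun m => forall i, (i < k (nsnd m))%N ->
    W (npair (nfst m) (npair (nsnd m) i))).
  apply: (@semidec_forall_lt
    (fun m i => W (npair (nfst m) (npair (nsnd m) i)))).
    by apply: (semidec_comp HW); rec.
  by rec.
have WPi z n i : P z n i <->
    exists2 l, W (npair l (npair n i)) & basic_open S l z.
  by have := WP z (npair n i); rewrite !npairK.
move=> z n; split; last first.
  move=> [l Wl Sl] i ltik; apply/WPi; exists l => //.
  by have := Wl i; rewrite !npairK; apply.
move=> Pn.
suff [l Wl Sl] : exists2 l, (forall i, (i < k n)%N -> W (npair l (npair n i)))
    & basic_open S l z.
  by exists l => // i; rewrite !npairK; exact: Wl.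
elim: (k n) Pn => [|j IHj] Pn.
  by exists 0%N => // i; rewrite seq_of_nat0.
have [|l Wl Sl] := IHj; first by move=> i ij; apply: Pn; rewrite ltnS ltnW.
have /WPi[l' Wl' Sl'] := Pn j (ltnSn j).
have [h hE] := seq_of_nat_surj (seq_of_nat l ++ seq_of_nat l').
exists h; last by move=> i; rewrite hE mem_cat => /orP[/Sl|/Sl'].
move=> i; rewrite ltnS leq_eqVlt => /predU1P[->|/Wl Wi].
  by apply: Wmon Wl' => u ul; rewrite hE mem_cat ul orbT.
by apply: Wmon Wi => u ul; rewrite hE mem_cat ul.
Qed.

Lemma eff_open_forall_mem (P : Z -> nat -> nat -> Prop) f :
  eff_open S (fun z m => P z (nfst m) (nsnd m)) -> recursive f ->
  eff_open S (fun z n => forall i, i \in seq_of_nat (f n) -> P z n i).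
Proof.
move=> HP Hf; apply: (@eff_open_ext
  (fun z n => forall i, (i < nsize (f n))%N -> P z n (nnth (f n) i))) => [z n|].
  split=> [Pn i /(nthP 0%N)[j ltj <-]|Pn i lti]; first exact: Pn.
  by apply: Pn; exact: mem_nth.
apply: (@eff_open_forall_lt (fun z n i => P z n (nnth (f n) i))).
  by apply: (eff_open_comp2 HP); rec.
by rec.
Qed.

End eff_open.

(** Effective continuity need only be checked on a subbasis: a certificate for [P] is a finite list
    of facts about [h z], each certified in turn by facts about [z]. *)
Lemma eff_open_preimage {Z Z'} (S : nat -> set Z) (S' : nat -> set Z')
    (h : Z -> Z') P :
  eff_open S (fun z i => S' i (h z)) -> eff_open S' P ->
  eff_open S (fun z n => P (h z) n).
Proof.
move=> Sh [W HW WP]; apply: (@eff_open_ext _ _ (fun z n =>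
  exists l, W (npair l n) /\ forall i, i \in seq_of_nat l -> S' i (h z))).
  by move=> z n; rewrite WP; split=> -[l] => [[Wl Sl]|Wl Sl]; exists l.
apply: (@eff_open_ex _ _ (fun z n l =>
  W (npair l n) /\ forall i, i \in seq_of_nat l -> S' i (h z))).
apply: eff_open_and.
  apply: (@eff_open_semidec _ _ (fun m => W (npair (nsnd m) (nfst m)))).
  by apply: (semidec_comp HW); rec.
apply: (@eff_open_forall_mem _ _ (fun z n i => S' i (h z))); last by rec.
by apply: (eff_open_comp Sh); rec.
Qed.

(** * Integrals and unions as limits of finitely many measurements *)

Lemma cvge_gt_ex (R : realType) (u : (\bar R)^nat) (l b : \bar R) :
  u @ \oo --> l -> (b < l)%E -> exists n, forall m, (n <= m)%N -> (b < u m)%E.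
Proof. by move=> ul /open_ereal_gt' /ul[n _ nu]; exists n => m /nu. Qed.

Lemma invS_lt (R : realType) (e : R) : 0 < e -> exists n : nat, n.+1%:R^-1 < e.
Proof.
move=> e0; have [n _ /(_ n (leqnn n))] := near_infty_natSinv_lt (PosNum e0).
by exists n.
Qed.

Section layers.
Context {R : realType}.

(** The sum counts the integers from 1 to [K] lying strictly below [z]. *)
Lemma sum_layers_le (z : R) K : 0 <= z ->
  \sum_(k < K) (k.+1%:R < z)%R%:R <= z.
Proof.
move=> z0; elim: K => [|K IH]; first by rewrite big_ord0.
rewrite big_ord_recr/=; case: ltP => [Kz|_]; last by rewrite addr0.
rewrite mulr1n.
apply: le_trans (ltW Kz); rewrite -natr1 lerD2r.
apply: le_trans (_ : \sum_(k < K) 1 <= _); last by rewrite sumr_const card_ord.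
by apply: ler_sum => k _; case: (_ < _).
Qed.

Lemma sum_layers_ge (z : R) K :
  Num.min z K%:R <= \sum_(k < K) (k.+1%:R < z)%R%:R + 1.
Proof.
(* The induction needs the sharper bound with [K.+1]. *)
suff : Num.min z K.+1%:R <= \sum_(k < K) (k.+1%:R < z)%R%:R + 1.
  by apply: le_trans; rewrite le_min !ge_min lexx/= ler_nat leqnSn orbT.
elim: K => [|K IH]; first by rewrite big_ord0 add0r ge_min lexx orbT.
rewrite big_ord_recr/=; case: (ltP K.+1%:R z) => Kz.
  rewrite mulr1n.
  move: IH; rewrite (min_idPr (ltW Kz)) => IH.
  by rewrite ge_min; apply/orP; right; rewrite -(natr1 K.+1); lra.
by move: IH; rewrite (min_idPl Kz) addr0 => IH; rewrite ge_min IH.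
Qed.

Local Open Scope ereal_scope.

(* Lower Riemann sums of the layer cake formula, with step [N.+1^-1]. *)
Lemma integral_gt_layersP d (T : measurableType d) (m : probability T R)
    (phi : T -> \bar R) (mphi : measurable_fun [set: T] phi)
    (phi0 : forall x, 0 <= phi x) (q : R) :
  q%:E < \int[m]_x phi x <->
  exists N K : nat, (q * N.+1%:R)%:E <
    \sum_(k < K) m [set x | (k.+1%:R / N.+1%:R)%:E < phi x].
Proof.
pose E (N k : nat) := [set x | (k.+1%:R / N.+1%:R)%:E < phi x].
have mE N k : measurable (E N k).
  by rewrite -[E N k]setTI; exact: emeasurable_fun_o_infty.
have layerE (N k : nat) (r : R) x : phi x = r%:E ->
    (\1_(E N k) x = (k.+1%:R < N.+1%:R * r)%R%:R :> R)%R.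
  move=> phir; rewrite indicE.
  have -> : (x \in E N k) = (k.+1%:R / N.+1%:R < r)%R.
    by apply/idP/idP; rewrite in_setE /E /= phir lte_fin.
  by rewrite ltr_pdivrMr// mulrC.
have sumE N K : \sum_(k < K) m (E N k) =
    \int[m]_x (\sum_(k < K) (\1_(E N k) x)%:E).
  rewrite ge0_integral_sum//.
    by apply: eq_bigr => k _; rewrite integral_indic// setIT.
  by move=> k; apply/measurable_EFinP.
have mS N K : measurable_fun [set: T] 
      (fun x => \sum_(k < K) (\1_(E N k) x : R)%:E).
  by apply: emeasurable_sum => k; apply/measurable_EFinP.
split=> [qphi|[N [K]]]; last first.
  rewrite -/(E _ _) sumE => qS.
  rewrite -(@lte_pmul2r _ N.+1%:R%:E) ?lte_fin// -EFinM.
  apply: lt_le_trans qS _.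
  rewrite muleC -ge0_integralZl//; apply: ge0_le_integral => //.
  - by move=> x _; apply: sume_ge0 => k _; rewrite lee_fin.
  - exact: measurable_funeM.
  - move=> x _; have := phi0 x; case phix : (phi x) => [r||]//; last first.
      by move=> _; rewrite mulry gtr0_sg// mul1e leey.
    rewrite lee_fin => r0; rewrite sumEFin -EFinM lee_fin.
    under eq_bigr do rewrite (layerE _ _ _ _ phix).
    by apply: sum_layers_le; rewrite mulr_ge0.
(* The integral may be infinite; truncation at a large height [M] makes it finite while keeping it
   above [q]. *)
pose g n x := mine (phi x) n%:R%:E.
have g0 n x : 0 <= g n x by rewrite le_min phi0 lee_fin/=.
have mg n : measurable_fun [set: T] (g n) by exact: measurable_mine.
have [M] : exists M, q%:E < \int[m]_x g M x.
  have cvg_g : \int[m]_x g n x @[n --> \oo] --> \int[m]_x phi x.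
    rewrite (_ : (\int[m]_x phi x) = \int[m]_x limn (g ^~ x)).
      apply: cvg_monotone_convergence => // x _ a b ab.
      by rewrite le_min !ge_min lexx/= lee_fin ler_nat ab orbT.
    apply: eq_integral => x _; apply/esym/cvg_lim => //.
    have := phi0 x; rewrite /g; case: (phi x) => [r _||]//.
      apply: cvg_near_cst; exists (Num.truncn r).+1 => // n /= ltn.
      apply/min_idPl; rewrite lee_fin ltW//.
      by apply: lt_le_trans (truncnS_gt r) _; rewrite ler_nat.
    move=> _; apply/cvgeyPge => A; exists (Num.truncn A).+1 => // n /= ltn.
    rewrite le_min leey/= lee_fin ltW//.
    by apply: lt_le_trans (truncnS_gt A) _; rewrite ler_nat.
  by have [M gM] := cvge_gt_ex cvg_g qphi; exists M; exact: gM.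
have gfin : \int[m]_x g M x \is a fin_num.
  rewrite ge0_fin_numE; last exact: integral_ge0.
  apply: le_lt_trans (_ : \int[m]_x (cst M%:R%:E x) < _).
    by apply: ge0_le_integral => // x _; rewrite ge_min lexx orbT.
  by rewrite integral_cst//= probability_setT mule1 ltry.
rewrite -(fineK gfin) lte_fin; set I := fine _ => qI.
have Iq : (0 < I - q)%R by rewrite subr_gt0.
(* After scaling by [N.+1] the layer sum loses at most 1, less than the scaled gap [N.+1 * (I - q)];
   levels of step [1 / N.+1] need [N.+1 * M] terms to reach height [M]. *)
have [N NIq] := invS_lt Iq; exists N, (N.+1 * M)%N.
rewrite -/(E _ _) sumE.
have : (N.+1%:R * I)%:E <=
    \int[m]_x (\sum_(k < N.+1 * M) (\1_(E N k) x)%:E) + 1.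
  rewrite EFinM fineK// -ge0_integralZl//.
  rewrite -[X in _ + X](_ : \int[m]_x cst 1 x = 1); last first.
    rewrite integral_cst// mul1e; exact: probability_setT.
  rewrite -ge0_integralD//; last first.
    by move=> x _; apply: sume_ge0 => k _; rewrite lee_fin.
  apply: ge0_le_integral => //.
  - by move=> x _; rewrite mule_ge0.
  - exact: measurable_funeM.
  - by apply: emeasurable_funD.
  - move=> x _; have := phi0 x; rewrite /g; case phix : (phi x) => [r||]//.
      move=> r0; rewrite sumEFin -EFin_min -EFinM lee_fin.
      under eq_bigr do rewrite (layerE _ _ _ _ phix).
      by have := sum_layers_ge (N.+1%:R * r) (N.+1 * M); rewrite natrM minr_pMr.
    move=> _; rewrite min_r ?leey// -EFinM.
    rewrite (eq_bigr (fun=> 1%:E)) => [|k _].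
      rewrite sumEFin sumr_const card_ord -EFinD lee_fin natrM.
      by rewrite lerDl.
    by rewrite indicE mem_set// /E /= phix ltry.
case: (\int[m]_x _) => [s||]//=.
- rewrite -EFinD !lee_fin !lte_fin.
  have : (0 < N.+1%:R :> R)%R by [].
  by move=> u0; move: NIq; rewrite -(ltr_pM2l u0) divff// mulrBr; lra.
- by rewrite ltry.
Qed.

(** Continuity from below along the unions over the indices of [C] less than [n]. The list is
    obtained by filtering classically: it has to exist, not to be computed. *)
Lemma measure_bigcup_gtP d (T : measurableType d)
    (m : {measure set T -> \bar R}) (B : nat -> set T)
    (mB : forall i, measurable (B i)) (C : nat -> Prop) b :
  b < m (\bigcup_(i in C) B i) <->
  exists2 l, (forall i, i \in seq_of_nat l -> C i) &
    b < m (\bigcup_(i in [set` seq_of_nat l]) B i).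
Proof.
have mU (D : set nat) : measurable (\bigcup_(i in D) B i).
  exact: bigcup_measurable.
split=> [bm|[l lC bl]]; last first.
  apply: (lt_le_trans bl); apply: le_measure; rewrite ?inE//.
  by apply: bigcup_subset => i /= /lC.
pose F n := \bigcup_(i in [set i | C i /\ (i < n)%N]) B i.
have FE : \bigcup_n F n = \bigcup_(i in C) B i.
  apply/seteqP; split=> x [i].
    by move=> _ [j [Cj _] Bx]; exists j.
  by move=> Ci Bx; exists i.+1 => //; exists i.
have mF i : measurable (F i) by exact: mU.
have ndF : nondecreasing_seq F.
  move=> i j ij; apply/subsetPset; apply: bigcup_subset => k [Ck ki].
  by split=> //; exact: leq_trans ki ij.
have := @nondecreasing_cvg_mu _ _ _ m F mF.
rewrite FE => /(_ (mU _) ndF) /cvge_gt_ex /(_ bm)[n bF].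
have [l lE] := seq_of_nat_surj [seq i <- iota 0 n | `[< C i >]].
exists l => [i|]; first by rewrite lE mem_filter => /andP[/asboolP].
apply: lt_le_trans (bF n (leqnn n)) _; apply: le_measure; rewrite ?inE//.
apply: bigcup_subset => i [Ci ltin] /=; rewrite lE mem_filter mem_iota.
by rewrite /= add0n ltin andbT; apply/asboolP.
Qed.

End layers.

(** * Borel measures on a computable metric space *)

Section borel_sets.
Context {R : realType} {X : cmspace R}.
Implicit Types (A : set X) (e : R).

Lemma open_mball (x : X) e : open [set y : X | mdist x y < e].
Proof.
rewrite openE => y /= xy; apply/nbhs_ballP; exists (e - mdist x y).
  by rewrite /= subr_gt0.
move=> z; rewrite ballEmdist/= => yz.
by apply: le_lt_trans (metric_triangle _ y _) _; rewrite -ltrBrDl.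
Qed.

Lemma open_borel A : open A -> measurable (A : set (borel X)).
Proof. by move=> oA; apply: sub_sigma_algebra. Qed.

Definition enlarge A e : set X := [set x | exists2 y, A y & mdist x y < e].

Lemma open_enlarge A e : open (enlarge A e).
Proof.
rewrite (_ : enlarge A e = \bigcup_(y in A) [set x | mdist y x < e]).
  by apply: bigcup_open => y _; exact: open_mball.
by apply/seteqP; split=> x [y Ay xy]; exists y => //=; rewrite metric_sym.
Qed.

Lemma measurable_enlarge A e : measurable (enlarge A e : set (borel X)).
Proof. by apply: open_borel; exact: open_enlarge. Qed.

Lemma sub_enlarge A B e : A `<=` B -> enlarge A e `<=` enlarge B e.
Proof. by move=> AB x [y /AB By xy]; exists y. Qed.

Lemma open_cm_basis i : open (cm_basis X i).
Proof. exact: open_mball. Qed.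

Definition ball_union (u : nat) : set X :=
  \bigcup_(i in [set` seq_of_nat u]) cm_basis X i.

Lemma open_ball_union u : open (ball_union u).
Proof. by apply: bigcup_open => i _; exact: open_cm_basis. Qed.

Lemma measurable_ball_union u : measurable (ball_union u : set (borel X)).
Proof. by apply: open_borel; exact: open_ball_union. Qed.

Lemma pmeas_fineK (mu : pmeas X) (A : set (borel X)) : measurable A ->
  mu A = (fine (mu A))%:E.
Proof. by move=> mA; rewrite fineK// fin_num_measure. Qed.

(** Apply the hypothesis to the complement of [enlarge A e]: by symmetry of the distance, the
    [e]-neighbourhood of that complement misses [A]. Both total masses are 1, so complements turn
    the inequality around. *)
Lemma prokhorov_one_sided (mu nu : pmeas X) e :
  (forall A : set (borel X), measurable A ->
    (mu A <= nu (enlarge A e) + e%:E)%E) ->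
  forall A : set (borel X), measurable A ->
    (nu A <= mu (enlarge A e) + e%:E)%E.
Proof.
move=> munu A mA; have mAe := measurable_enlarge A e.
have mC : measurable (~` enlarge A e : set (borel X)) by exact: measurableC.
have := munu _ mC; rewrite probability_setC//.
have : (nu (enlarge (~` enlarge A e) e) <= 1 - nu A)%E.
  rewrite -probability_setC//; apply: le_measure; rewrite ?inE.
  - exact: measurable_enlarge.
  - exact: measurableC.
  - move=> x [y yA xy] Ax; apply: yA; exists x => //.
    by rewrite metric_sym.
rewrite (pmeas_fineK mu mAe) (pmeas_fineK nu mA).
rewrite (pmeas_fineK nu (measurable_enlarge _ e)).
by rewrite -!EFinB -!EFinD !lee_fin; lra.
Qed.

Lemma prokhorov_ltP (mu nu : pmeas X) rho : prokhorov mu nu < rho <->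
  exists2 e, 0 < e < rho & forall A : set (borel X), measurable A ->
    (mu A <= nu (enlarge A e) + e%:E)%E.
Proof.
rewrite /prokhorov; set E := (E in inf E); split=> [lt_rho|[e /andP[e0 er] He]].
  have [|e [e0 He] er] := inf_lt _ lt_rho; last first.
    by exists e; [rewrite e0|move=> A /He[]].
  (* The infimum is taken over a nonempty set: 1 bounds every probability. *)
  exists 1; split=> // A mA; split.
    by apply: le_trans (probability_le1 mu mA) _; rewrite leeDr.
  by apply: le_trans (probability_le1 nu mA) _; rewrite leeDr.
apply: le_lt_trans er; apply: ge_inf; first by exists 0 => x [/ltW].
by split=> // A mA; split; [exact: He|exact: prokhorov_one_sided mA].
Qed.

End borel_sets.
Arguments ball_union {R} X u.

(** * Finitely supported rational measures as lists of weighted atoms *)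

Section rational_measures.

Definition code_weight (n : nat) : nat :=
  (\sum_(k < nsize n) nsnd (nnth n k))%N.

(* Codes of weight zero denote the Dirac measure at [alpha 0]. *)
Definition atoms (n : nat) : nat :=
  if code_weight n == 0%N then lcons (npair 0 1) 0 else n.
Definition atom_count n : nat := nsize (atoms n).
Definition atom_index n k : nat := nfst (nnth (atoms n) k).
Definition atom_weight n k : nat := nsnd (nnth (atoms n) k).

(** The share of the weight carried by the atoms that [p] selects. The weight of [atoms n] is
    positive, so [.-1.+1] keeps its value and gives the denominator the shape expected by
    [ratrec_invS]. *)
Definition mass (n : nat) (p : nat -> bool) : rat :=
  (\sum_(k < atom_count n) p k * atom_weight n k)%N%:R /
  (code_weight (atoms n)).-1.+1%:R.

Context {R : realType} {X : cmspace R}.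

(** The total weight is finite, so [mnormalize] takes its default measure exactly when the weight is
    0, which is the case that [atoms] replaces by one atom of weight 1. *)
Lemma pmeas_alphaE n (A : set (borel X)) : pmeas_alpha X n A =
  (ratr (mass n (fun k => cm_alpha X (atom_index n k) \in A)))%:E.
Proof.
have sE (B : set (borel X)) : msum (fun k =>
    mscale ((nsnd (nth 0%N (seq_of_nat n) k))%:R%:nng : {nonneg R})
      (@dirac _ (borel X) (cm_alpha X (nfst (nth 0%N (seq_of_nat n) k))) R))
    (size (seq_of_nat n)) B = ((\sum_(k < nsize n)
      (cm_alpha X (nfst (nnth n k)) \in B) * nsnd (nnth n k))%N%:R)%:E.
  rewrite /msum natr_sum -sumEFin; apply: eq_bigr => k _.
  transitivity ((nsnd (nnth n k))%:R%:E *
    (\1_B (cm_alpha X (nfst (nnth n k)) : borel X))%:E : \bar R)%E => //.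
  by rewrite indicE -EFinM natrM mulrC.
rewrite /pmeas_alpha/= /mnormalize/= !sE.
rewrite (eq_bigr (fun k : 'I__ => nsnd (nnth n k))) => [|k _]; last first.
  by rewrite in_setT mul1n.
rewrite -/(code_weight n) orbF eqe pnatr_eq0.
rewrite /mass /atom_count /atom_index /atom_weight /atoms.
have [s0|s0] := eqVneq (code_weight n) 0%N; last first.
  by rewrite sE /= -EFinM fmorph_div/= !ratr_nat prednK ?lt0n.
rewrite /code_weight /nsize /nnth seq_of_nat_cons seq_of_nat0 /=.
rewrite !big_ord_recl !big_ord0/= !npairK !addn0 muln1.
by rewrite divr1 ratr_nat; exact: diracE.
Qed.

Lemma le_mass n (p q : nat -> bool) :
  (forall k, (k < atom_count n)%N -> p k -> q k) -> mass n p <= mass n q.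
Proof.
move=> pq; rewrite /mass ler_pM2r ?invr_gt0// ler_nat; apply: leq_sum => k _.
by have := pq k (ltn_ord k); case: (p k) => //= ->.
Qed.

Lemma eq_mass n (p q : nat -> bool) :
  (forall k, (k < atom_count n)%N -> p k = q k) -> mass n p = mass n q.
Proof.
by move=> pq; apply/eqP; rewrite eq_le !le_mass// => k /pq ->.
Qed.

End rational_measures.

(** * Effective neighbourhoods of a measure *)

(** Binary digits let the numbers below [2 ^ n] code all subsets of [n] atoms. Halving is written as
    a sum because recursiveness of bounded sums is available. *)
Definition nhalf (c : nat) : nat := (\sum_(i < c) odd i)%N.
Definition nbit (c k : nat) : bool := odd (iter k nhalf c).

Lemma nhalfE c : nhalf c = c./2.
Proof.
rewrite /nhalf; elim: c => [|c IH]; first by rewrite big_ord0.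
by rewrite big_ord_recr/= IH uphalf_half addnC.
Qed.

Lemma nbit_surj (p : nat -> bool) n :
  exists2 c, (c < 2 ^ n)%N & forall k, (k < n)%N -> nbit c k = p k.
Proof.
elim: n p => [|n IH] p; first by exists 0%N.
have [c cn cp] := IH (p \o succn); exists (p 0%N + c.*2)%N.
  by rewrite expnS mul2n; case: (p 0%N); lia.
have half_c : nhalf (p 0%N + c.*2) = c.
  by rewrite nhalfE half_bit_double.
case=> [_|k]; first by rewrite /nbit /= oddD odd_double addbF; case: (p 0%N).
by rewrite ltnS => kn; rewrite -[RHS](cp k kn) /nbit iterSr half_c.
Qed.

Lemma decidable_odd f : recursive f -> decidable_pred (fun n => odd (f n)).
Proof.
move=> Hf; apply: (@recursive_ext
  (fun n => nat_rec _ 0%N (fun _ s => 1 - s)%N (f n))) => [n|].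
  by elim: (f n) => //= k ->; case: (odd k).
by apply: (@recursive_nat_rec (fun=> 0%N) (fun _ _ s => 1 - s)%N); rec.
Qed.

Lemma decidable_nbit f g : recursive f -> recursive g ->
  decidable_pred (fun n => nbit (f n) (g n)).
Proof.
move=> Hf Hg; apply: decidable_odd.
apply: (@recursive_ext
  (fun n => nat_rec _ (f n) (fun _ s => nhalf s) (g n))) => [n|].
  by elim: (g n) => [|k /= ->].
apply: (@recursive_nat_rec f (fun _ _ s => nhalf s) g) => //.
apply: (@recursive_sum (fun _ i => odd i) (fun m => nsnd (nsnd m)));
  last by rec.
exact: decidable_odd recursive_nsnd.
Qed.

Lemma recursive_exp2 f : recursive f -> recursive (fun n => 2 ^ f n)%N.
Proof.
move=> Hf; apply: (@recursive_ext
  (fun n => nat_rec _ 1%N (fun _ s => s + s)%N (f n))) => [n|].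
  by elim: (f n) => //= k ->; rewrite expnS mul2n addnn.
by apply: (@recursive_nat_rec (fun=> 1%N) (fun _ _ s => s + s)%N); rec.
Qed.

Lemma recursive_code_weight f :
  recursive f -> recursive (fun n => code_weight (f n)).
Proof.
move=> Hf; apply: (@recursive_sum (fun n k => nsnd (nnth (f n) k))); rec.
Qed.

Lemma recursive_atoms f : recursive f -> recursive (fun n => atoms (f n)).
Proof.
move=> Hf; apply: recursive_if => //; last by rec.
by apply: decidable_eq0; exact: recursive_code_weight.
Qed.

Lemma recursive_atom_count f :
  recursive f -> recursive (fun n => atom_count (f n)).
Proof. by move=> Hf; apply: recursive_nsize; exact: recursive_atoms. Qed.

Lemma recursive_atom_index f g : recursive f -> recursive g ->
  recursive (fun n => atom_index (f n) (g n)).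
Proof.
move=> Hf Hg; rewrite /atom_index; rec_step.
by apply: recursive_nnth => //; exact: recursive_atoms.
Qed.

Lemma ratrec_mass_nbit f g : recursive f -> recursive g ->
  ratrec (fun n => mass (f n) (nbit (g n))).
Proof.
move=> Hf Hg; apply: ratrec_mul.
  apply/ratrec_nat/(@recursive_sum
    (fun n k => nbit (g n) k * atom_weight (f n) k)%N).
    apply: recursive_mul; first by apply: decidable_nbit; rec.
    rewrite /atom_weight; rec_step; apply: recursive_nnth; last by rec.
    by apply: recursive_atoms; rec.
  exact: recursive_atom_count.
apply: ratrec_invS; apply: (recursive_comp recursive_pred).
by apply: recursive_code_weight; exact: recursive_atoms.
Qed.

(* The bits of [c] select a set of atoms; all balls have radius
   [prat_of_nat e]. *)
Definition atom_balls (n c e : nat) : nat :=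
  nat_rec _ 0%N (fun k l => if nbit c k
    then lcons (npair (atom_index n k) e) l else l) (atom_count n).

Lemma mem_atom_balls n c e i : i \in seq_of_nat (atom_balls n c e) <->
  exists k, [/\ (k < atom_count n)%N, nbit c k & i = npair (atom_index n k) e].
Proof.
rewrite /atom_balls; elim: (atom_count n) => [|m IH] /=.
  by rewrite seq_of_nat0; split=> // -[k []].
set l := nat_rec _ _ _ _ in IH *; split.
  case: ifPn => [bm|_ /IH[k [km bk ->]]]; last first.
    by exists k; rewrite ltnW.
  rewrite seq_of_nat_cons inE => /predU1P[->|/IH[k [km bk ->]]].
    by exists m.
  by exists k; rewrite ltnW.
move=> [k [+ bk iE]]; rewrite ltnS leq_eqVlt => /predU1P[km|km].
  by rewrite -km bk seq_of_nat_cons iE mem_head.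
have /IH il : exists k0, [/\ (k0 < m)%N, nbit c k0 &
  i = npair (atom_index n k0) e] by exists k.
by case: ifP => // _; rewrite seq_of_nat_cons inE il orbT.
Qed.

Lemma recursive_atom_balls f g h : recursive f -> recursive g -> recursive h ->
  recursive (fun n => atom_balls (f n) (g n) (h n)).
Proof.
move=> Hf Hg Hh; apply: (@recursive_nat_rec (fun=> 0%N)
  (fun n k l => if nbit (g n) k
    then lcons (npair (atom_index (f n) k) (h n)) l else l)).
- by rec.
- apply: recursive_if; [by apply: decidable_nbit; rec| |by rec].
  by rewrite /lcons; rec; apply: recursive_atom_index; rec.
- exact: recursive_atom_count.
Qed.

Section pmeas_neighbourhoods.
Context {R : realType} {X : cmspace R}.

Definition atom_set (n : nat) (p : nat -> bool) : set X :=
  [set y | exists k, [/\ (k < atom_count n)%N, p k &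
    y = cm_alpha X (atom_index n k)]].

Lemma ball_union_atom_balls n c e : ball_union X (atom_balls n c e) =
  enlarge (atom_set n (nbit c)) (ratr (prat_of_nat e)).
Proof.
apply/seteqP; split=> x.
  move=> [i /= /mem_atom_balls[k [kn ck ->]]].
  rewrite /cm_basis /ball_basis /= !npairK => d.
  exists (cm_alpha X (atom_index n k)); first by exists k.
  by rewrite metric_sym.
move=> [_ [k [kn ck ->]] d]; exists (npair (atom_index n k) e).
  by apply/mem_atom_balls; exists k.
by rewrite /cm_basis /ball_basis /= !npairK metric_sym.
Qed.

Lemma enlarge_enlarge (A : set X) e e' :
  enlarge (enlarge A e) e' `<=` enlarge A (e + e').
Proof.
move=> x [y [z Az yz] xy]; exists z => //.
by apply: le_lt_trans (metric_triangle _ y _) _; rewrite addrC ltrD.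
Qed.

Lemma le_pmeas_alpha n (p : nat -> bool) (A : set (borel X)) :
  (forall k, (k < atom_count n)%N -> p k -> A (cm_alpha X (atom_index n k))) ->
  ((ratr (mass n p))%:E <= pmeas_alpha X n A)%E.
Proof.
move=> pA; rewrite pmeas_alphaE lee_fin ler_rat; apply: le_mass => k kn pk.
by rewrite in_setE; exact: pA.
Qed.

Lemma sub_atom_set_enlarge n (p : nat -> bool) (d : R) k : 0 < d ->
  (k < atom_count n)%N -> p k ->
  enlarge (atom_set n p) d (cm_alpha X (atom_index n k)).
Proof.
move=> d0 kn pk; exists (cm_alpha X (atom_index n k)); first by exists k.
by rewrite mdistxx.
Qed.

Lemma prat_of_nat_gt0 e : 0 < prat_of_nat e.
Proof. by rewrite divr_gt0. Qed.

Lemma prat_between (x y : R) : 0 <= x -> x < y ->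
  exists e, x < ratr (prat_of_nat e) < y.
Proof.
move=> x0 /rat_in_itvoo[q]; rewrite in_itv/= => /andP[xq qy].
have [|e eq] := @prat_of_nat_surj q.
  by rewrite -(ltr_rat R) rmorph0 (le_lt_trans x0).
by exists e; rewrite eq xq.
Qed.

(* Since the centre of the ball is finitely supported, being in the ball is
   decided by the measures of finitely many unions of balls. *)
Lemma pmeas_basisP i (nu : pmeas X) : pmeas_basis X i nu <->
  exists e, prat_of_nat e < prat_of_nat (nsnd i) /\
    forall c, (c < 2 ^ atom_count (nfst i))%N ->
      ((ratr (mass (nfst i) (nbit c) - prat_of_nat e))%:E <
       nu (ball_union X (atom_balls (nfst i) c e)))%E.
Proof.
rewrite /pmeas_basis /ball_basis /=; set n := nfst i; set r := prat_of_nat _.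
split=> [/prokhorov_ltP[e0 /andP[e00 e0r] He]|[e [er He]]]; last first.
  apply/prokhorov_ltP; exists (ratr (prat_of_nat e)).
    by rewrite ltr_rat er ltr0q prat_of_nat_gt0.
  move=> A mA.
  (* Only the atoms inside [A] count for the rational measure, and their neighbourhood lies in that
     of [A]; so finitely many sets represent all Borel sets. *)
  have [c cn cp] :=
    nbit_surj (fun k => cm_alpha X (atom_index n k) \in A) (atom_count n).
  rewrite pmeas_alphaE -(eq_mass cp).
  have := ltW (He c cn); rewrite rmorphB/= EFinB leeBlDr//.
  move/le_trans; apply; apply: leeD => //; apply: le_measure; rewrite ?inE.
  - exact: measurable_ball_union.
  - exact: measurable_enlarge.
  - rewrite ball_union_atom_balls; apply: sub_enlarge => _ [k [kn + ->]].
    by rewrite cp// in_setE.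
have [e /andP[e0e er]] := prat_between (ltW e00) e0r.
exists e; split; first by rewrite ltr_rat in er.
move=> c cn; set S := atom_set n (nbit c).
(* The slack [e - e0] thickens the finite set of atoms into an open, hence measurable, set whose
   [e0]-neighbourhood still lies in the [e]-neighbourhood of the atoms. *)
have d0 : 0 < ratr (prat_of_nat e) - e0 by rewrite subr_gt0.
have := He _ (measurable_enlarge S (ratr (prat_of_nat e) - e0)).
have /le_trans h := @le_pmeas_alpha n (nbit c)
  (enlarge S (ratr (prat_of_nat e) - e0))
  (fun k kn ck => sub_atom_set_enlarge d0 kn ck).
move=> /h {}h; rewrite rmorphB/= EFinB lteBlDr//; apply: le_lt_trans h _.
rewrite (pmeas_fineK nu (measurable_enlarge _ _)).
rewrite (pmeas_fineK nu (measurable_ball_union _)) -!EFinD lte_fin.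
apply: ler_ltD => //; rewrite fine_le ?fin_num_measure//;
  try exact: measurable_enlarge; try exact: measurable_ball_union.
apply: le_measure; rewrite ?inE; try exact: measurable_enlarge.
  exact: measurable_ball_union.
rewrite ball_union_atom_balls; move=> x /enlarge_enlarge.
by rewrite subrK.
Qed.

End pmeas_neighbourhoods.

(** * Semidecidable certificates for inclusions between neighbourhoods *)

Section certificates.
Context {R : realType} {X : cmspace R}.

Lemma semidec_mdist f g h : recursive f -> recursive g -> ratrec h ->
  semidec (fun n => mdist (cm_alpha X (f n)) (cm_alpha X (g n)) < ratr (h n)).
Proof.
move=> Hf Hg Hh; have [c cd] := cm_dist X.
have /choice[F FP] : forall n, exists q, prf_eval c n q /\ `|mdist
    (cm_alpha X (nfst (nfst n))) (cm_alpha X (nsnd (nfst n))) -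
      ratr (rat_of_nat q)| <= 2 ^- nsnd n.
  move=> n; have [q] := cd (nfst (nfst n)) (nsnd (nfst n)) (nsnd n).
  by rewrite !nunpairK; exists q.
have HF : recursive F by exists c => n; have [] := FP n.
have {}FP v w k : `|mdist (cm_alpha X v) (cm_alpha X w) -
    ratr (rat_of_nat (F (npair (npair v w) k)))| <= 2 ^- k.
  by have [_] := FP (npair (npair v w) k); rewrite !npairK.
apply: (@semidec_ext (fun n => exists k,
    rat_of_nat (F (npair (npair (f n) (g n)) k)) + 2 ^- k < h n)); last first.
  apply: (@semidec_ex (fun n k =>
    rat_of_nat (F (npair (npair (f n) (g n)) k)) + 2 ^- k < h n)).
  apply: decidable_semidec; apply: decidable_ltr.
    by apply: ratrec_add; [apply: ratrec_code; rec|apply: ratrec_exp2V; rec].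
  by apply: ratrec_comp Hh _; rec.
have e2 (k : nat) : ratr (2 ^- k) = 2 ^- k :> R.
  by rewrite fmorphV rmorphXn/= ratr_nat.
move=> n; split=> [[k]|dh].
  rewrite -(ltr_rat R) rmorphD/= e2.
  have := FP (f n) (g n) k; rewrite ler_distl => /andP[_].
  by move=> /le_lt_trans; apply.
(* Half the gap: the approximation may exceed the distance by [2 ^- k], and [2 ^- k] is added once
   more. *)
have : 0 < (ratr (h n) - mdist (cm_alpha X (f n)) (cm_alpha X (g n))) / 2.
  by rewrite divr_gt0// subr_gt0.
move=> /invS_lt[k kd]; exists k.
rewrite -(ltr_rat R) rmorphD/= e2.
have ek : 2 ^- k <= k.+1%:R^-1 :> R.
  by rewrite lef_pV2 ?posrE ?exprn_gt0// -natrX ler_nat ltn_expl.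
have := FP (f n) (g n) k; rewrite ler_distlC => /andP[_].
by move: kd; set u := k.+1%:R^-1 in ek *; lra.
Qed.

(** Stronger than inclusion of the balls, but semidecidable, since distances between centres are
    computable. *)
Definition subball (i j : nat) : Prop :=
  mdist (cm_alpha X (nfst i)) (cm_alpha X (nfst j)) <
  ratr (prat_of_nat (nsnd j) - prat_of_nat (nsnd i)).

Lemma semidec_subball f g : recursive f -> recursive g ->
  semidec (fun n => subball (f n) (g n)).
Proof.
move=> Hf Hg; apply: semidec_mdist; [by rec|by rec|].
by apply: ratrec_sub; apply: ratrec_pcode; rec.
Qed.

Lemma subball_sub i j : subball i j -> cm_basis X i `<=` cm_basis X j.
Proof.
rewrite /subball rmorphB/= => d x; rewrite /cm_basis /ball_basis /= => dx.
apply: le_lt_trans (metric_triangle _ (cm_alpha X (nfst i)) _) _.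
by move: d; rewrite metric_sym; lra.
Qed.

Lemma subball_small j (x : X) : cm_basis X j x -> exists2 rho : R, 0 < rho &
  forall i, ratr (prat_of_nat (nsnd i)) <= rho -> cm_basis X i x -> subball i j.
Proof.
(* Half the gap, spent once on the distance from [x] to the new centre and once on the new
   radius. *)
rewrite /cm_basis /ball_basis /= => dx.
exists ((ratr (prat_of_nat (nsnd j)) - mdist (cm_alpha X (nfst j)) x) / 2).
  by rewrite divr_gt0// subr_gt0.
move=> i irho; rewrite /subball rmorphB/= => di.
apply: le_lt_trans (metric_triangle _ x _) _.
by rewrite (metric_sym x); lra.
Qed.

Lemma cm_alpha_near (x : X) (e : R) : 0 < e ->
  exists a, mdist (cm_alpha X a) x < e.
Proof.
move=> e0; have [||y [xy [a _ ay]]] := @cm_dense R X [set y | mdist x y < e].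
- by exists x => /=; rewrite mdistxx.
- exact: open_mball.
- by exists a; rewrite ay metric_sym.
Qed.

(** By the portmanteau theorem such sets generate the weak topology; all effective statements about
    measures go through them. *)
Definition weak_subbasis (s : nat) : set (pmeas X) :=
  [set mu | ((ratr (rat_of_nat (nsnd s)))%:E < mu (ball_union X (nfst s)))%E].

(* A certificate for the inclusion of the Prokhorov ball [i] in
   [weak_subbasis s]: enough mass sits on atoms whose ball of radius that of
   [i] lies in the union. *)
Definition sub_weak (i s : nat) : Prop := exists c,
  (forall k, (k < atom_count (nfst i))%N -> ~~ nbit c k \/
    exists m, m \in seq_of_nat (nfst s) /\
      subball (npair (atom_index (nfst i) k) (nsnd i)) m) /\
  rat_of_nat (nsnd s) + prat_of_nat (nsnd i) < mass (nfst i) (nbit c).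

Lemma semidec_sub_weak f g : recursive f -> recursive g ->
  semidec (fun n => sub_weak (f n) (g n)).
Proof.
move=> Hf Hg; pose Q n c k := ~~ nbit c k \/ exists m,
  nmem (nfst (g n)) m /\
  subball (npair (atom_index (nfst (f n)) k) (nsnd (f n))) m.
apply: (@semidec_ex (fun n c =>
  (forall k, (k < atom_count (nfst (f n)))%N -> Q n c k) /\
  rat_of_nat (nsnd (g n)) + prat_of_nat (nsnd (f n)) <
    mass (nfst (f n)) (nbit c))).
apply: semidec_and.
  apply: (@semidec_forall_lt (fun m k => Q (nfst m) (nsnd m) k)); last first.
    by apply: recursive_atom_count; rec.
  apply: semidec_or.
    by apply/decidable_semidec/decidable_neg/decidable_nbit; rec.
  apply: (@semidec_ex (fun q m => nmem (nfst (g (nfst (nfst q)))) m /\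
    subball (npair (atom_index (nfst (f (nfst (nfst q)))) (nsnd q))
      (nsnd (f (nfst (nfst q))))) m)).
  apply: semidec_and; first by apply/decidable_semidec/decidable_nmem; rec.
  by apply: semidec_subball; rec; apply: recursive_atom_index; rec.
apply: decidable_semidec; apply: decidable_ltr.
  by apply: ratrec_add; [apply: ratrec_code|apply: ratrec_pcode]; rec.
by apply: ratrec_mass_nbit; rec.
Qed.

(** A measure at distance less than [r] from the centre gives the [r]-neighbourhood of the selected
    atoms their mass up to [r], and that neighbourhood lies in the union. As before, slack [r - e]
    makes the set of atoms measurable. *)
Lemma sub_weakP i s : sub_weak i s -> pmeas_basis X i `<=` weak_subbasis s.
Proof.
move=> [c [cu cm]] mu; rewrite /pmeas_basis /ball_basis /=.
set n := nfst i; set r : R := ratr _ => /prokhorov_ltP[e /andP[e0 er] He].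
have d0 : 0 < r - e by rewrite subr_gt0.
have mA : measurable (enlarge (atom_set n (nbit c)) (r - e) : set (borel X)).
  exact: measurable_enlarge.
have := He _ mA; have := @le_pmeas_alpha R X n (nbit c)
  (enlarge (atom_set n (nbit c)) (r - e))
  (fun k kn ck => sub_atom_set_enlarge d0 kn ck).
move=> /le_trans h /h {h}; rewrite -leeBlDr// -EFinB => h.
have le_U : (mu (enlarge (enlarge (atom_set n (nbit c)) (r - e)) e) <=
             mu (ball_union X (nfst s)))%E.
  apply: le_measure; rewrite ?inE.
  - exact: measurable_enlarge.
  - exact: measurable_ball_union.
  - move=> x /enlarge_enlarge; rewrite subrK => -[_ [k [kn ck ->]] xk].
    have [|[m [mu_m /subball_sub sm]]] := cu k kn; first by rewrite ck.
    exists m => //; apply: sm.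
    by rewrite /cm_basis /ball_basis /= !npairK metric_sym.
apply: lt_le_trans le_U; apply: lt_le_trans h; rewrite lte_fin.
by move: cm; rewrite -(ltr_rat R) rmorphD/= -/n -/r; lra.
Qed.

(** Shrink the balls of the union a little, keeping measure above [b]. A rational measure close to
    [mu] puts almost as much mass near the shrunken union, on atoms deep enough inside the original
    one. *)
Lemma sub_weak_small s (mu : pmeas X) : weak_subbasis s mu ->
  exists2 rho : R, 0 < rho & forall i, ratr (prat_of_nat (nsnd i)) <= rho ->
    pmeas_basis X i mu -> sub_weak i s.
Proof.
rewrite /weak_subbasis /=; set u := nfst s; set b := rat_of_nat _ => bmu.
(* With [v = 1 / n.+1], both the shrinking and the gain in measure are [3 * v]: enough for the
   Prokhorov error [e] and the radius [r], each at most [v]. *)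
pose U (n : nat) : set (borel X) := \bigcup_(m in [set` seq_of_nat u])
  [set x | mdist (cm_alpha X (nfst m)) x <
           ratr (prat_of_nat (nsnd m)) - 3 / n.+1%:R].
have mU n : measurable (U n).
  by apply: open_borel; apply: bigcup_open => m _; exact: open_mball.
have UE : \bigcup_n U n = ball_union X u.
  apply/seteqP; split=> x.
    move=> [n _ [m mu_m /= d]]; exists m => //.
    by apply: lt_le_trans d _; rewrite gerBl divr_ge0.
  move=> [m mu_m]; rewrite /cm_basis /ball_basis /= => d.
  have : 0 < (ratr (prat_of_nat (nsnd m)) - mdist (cm_alpha X (nfst m)) x) / 3.
    by rewrite divr_gt0// subr_gt0.
  move=> /invS_lt[n nd]; exists n => //; exists m => //=.
  by move: nd; set v := n.+1%:R^-1; lra.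
have ndU : nondecreasing_seq U.
  move=> i j ij; apply/subsetPset => x [m mu_m /= d]; exists m => //=.
  apply: lt_le_trans d _; rewrite lerD2l lerN2 ler_pM2l//.
  by rewrite lef_pV2 ?posrE// ler_nat.
have mbU : measurable (\bigcup_n U n).
  by rewrite UE; exact: measurable_ball_union.
have := @nondecreasing_cvg_mu _ _ _ mu U mU mbU ndU.
rewrite UE => /cvge_gt_ex/(_ bmu)[n0 Un0].
have : 0 < (fine (mu (U n0)) - ratr b) / 3.
  rewrite divr_gt0// subr_gt0 -lte_fin -pmeas_fineK//; exact: Un0.
move=> /invS_lt[n1 n1d]; pose n := maxn n0 n1.
pose v : R := n.+1%:R^-1.
have bn : ratr b + 3 * v < fine (mu (U n)).
  have : fine (mu (U n0)) <= fine (mu (U n)).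
    rewrite fine_le ?fin_num_measure//; apply: le_measure; rewrite ?inE//.
    by apply/subsetPset/ndU; rewrite leq_maxl.
  have : n.+1%:R^-1 <= n1.+1%:R^-1 :> R.
    by rewrite lef_pV2 ?posrE// ler_nat ltnS leq_maxr.
  by rewrite -/v; move: n1d; set w := n1.+1%:R^-1; lra.
exists v => //; first by rewrite invr_gt0.
move=> i; rewrite /pmeas_basis /ball_basis /=.
set a := nfst i; set r : R := ratr _ => rn /prokhorov_ltP[e /andP[e0 er] He].
have [c cn cp] := nbit_surj
  (fun k => cm_alpha X (atom_index a k) \in enlarge (U n) e) (atom_count a).
exists c; split.
  move=> k kn; rewrite cp//; case: (boolP (_ \in _)); last by left.
  rewrite in_setE => -[x [m mu_m /=]]; rewrite -/v => dm dx.
  right; exists m; split=> //.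
  rewrite /subball !npairK rmorphB/= -/a -/r.
  apply: le_lt_trans (metric_triangle _ x _) _.
  by rewrite (metric_sym x); lra.
(* Here a lower bound on the rational measure is wanted, so the inequality is used in the other
   direction. *)
have := prokhorov_one_sided He (mU n).
rewrite pmeas_alphaE (pmeas_fineK mu (mU n)) -EFinD lee_fin.
rewrite -(ltr_rat R) rmorphD/= -/r -/a (eq_mass cp); lra.
Qed.

End certificates.

(** * Density of the finitely supported rational measures *)

Section density.
Context {R : realType} {X : cmspace R}.

Lemma code_seq_measure (n : nat) (w : nat -> nat) : (0 < n)%N ->
  exists a, [/\ nsize a = n,
    forall k, (k < n)%N -> nnth a k = npair k (w k) &
    code_weight a = (\sum_(k < n) w k)%N].
Proof.
move=> n0; have [a aE] := seq_of_nat_surj (mkseq (fun k => npair k (w k)) n).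
have na : nsize a = n by rewrite /nsize aE size_mkseq.
have ak k : (k < n)%N -> nnth a k = npair k (w k).
  by move=> kn; rewrite /nnth aE nth_mkseq.
exists a; split=> //; rewrite /code_weight na; apply: eq_bigr => k _.
by rewrite ak// npairK.
Qed.

(** Finitely many [e]-balls carry mass more than [1 - e / 4]. Made disjoint, each piece sends its
    mass, rounded down to a multiple of [1 / N], to the centre of its ball, at distance less than
    [e]. *)
Lemma prokhorov_dense (mu : pmeas X) (rho : R) : 0 < rho ->
  exists a, prokhorov (pmeas_alpha X a) mu < rho.
Proof.
(* Capping [e] at 1/2 keeps the total weight [W] at least [N / 2], which controls the normalisation
   by [W] instead of [N]. *)
move=> rho0; pose e : R := Num.min rho 1 / 2.
have m0 : 0 < Num.min rho 1 by rewrite lt_min rho0 ltr01.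
have e0 : 0 < e by rewrite divr_gt0.
have e12 : e <= 1 / 2 by rewrite ler_pM2r ?invr_gt0// ge_min lexx orbT.
have er : e < rho.
  have : Num.min rho 1 <= rho by rewrite ge_min lexx.
  by rewrite /e; lra.
pose B n : set (borel X) := [set x | mdist (cm_alpha X n) x < e].
have mB n : measurable (B n) by apply: open_borel; exact: open_mball.
have coverB : \bigcup_n B n = setT.
  apply/seteqP; split=> // x _; have [a ax] := cm_alpha_near x e0.
  by exists a.
have [n [n0 nB]] : exists n, (0 < n)%N /\
    ((1 - e / 4)%:E < mu (\big[setU/set0]_(i < n) B i))%E.
  pose F n : set (borel X) := \big[setU/set0]_(i < n.+1) B i.
  have FU : \bigcup_n F n = setT by rewrite -coverB bigcup_bigsetU_bigcup.
  have mF n : measurable (F n) by apply: bigsetU_measurable.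
  have ndF : nondecreasing_seq F.
    move=> i j ij; apply/subsetPset; rewrite /F -!bigcup_mkord.
    apply: bigcup_subset => k /= ki; exact: leq_trans ki _.
  have := @nondecreasing_cvg_mu _ _ _ mu F mF.
  rewrite FU => /(_ measurableT ndF) /cvge_gt_ex.
  have mu1 : (mu setT = 1)%E by exact: probability_setT.
  move=> /(_ (1 - e / 4)%:E)[|n Fn].
    by rewrite [X in (_ < X)%E]mu1 lte_fin gtrBl divr_gt0.
  by exists n.+1; split=> //; exact: Fn.
pose D := seqDU B.
have mD i : measurable (D i) by exact: seqDU_measurable.
have sumD (V : set (borel X)) : measurable V ->
    \sum_(i < n) fine (mu (D i `&` V)) =
    fine (mu (\big[setU/set0]_(i < n) D i `&` V)).
  move=> mV; have mDV i : measurable (D i `&` V) by exact: measurableI.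
  apply: EFin_inj; rewrite -sumEFin.
  rewrite -pmeas_fineK; last first.
    by apply: measurableI => //; exact: bigsetU_measurable.
  rewrite big_distrl/= (@measure_semi_additive_ord_I _ _ _ mu
    (fun i => D i `&` V))//; last 2 first.
  - apply: sub_trivIset (subsetT _) _; apply: trivIset_setIr.
    exact: trivIset_seqDU.
  - exact: bigsetU_measurable.
  by apply: eq_bigr => i _; rewrite -pmeas_fineK.
pose m i : R := fine (mu (D i)).
have m_ge0 i : 0 <= m i by exact: fine_ge0.
have summ : 1 - e / 4 < \sum_(i < n) m i.
  have := sumD setT measurableT; rewrite setIT.
  rewrite (eq_bigr (fun i : 'I_n => m i)) => [->|i _]; last by rewrite setIT.
  rewrite -lte_fin -pmeas_fineK; last exact: bigsetU_measurable.
  by rewrite -bigsetU_seqDU.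
(* Rounding loses less than 1 on each of the [n] pieces; this choice makes the loss at most
   [N * (e / 4)], hence [W] at least [N * (1 - e / 2)]. *)
have [N0 N0e] := invS_lt (divr_gt0 e0 (ltr0n _ 4)).
pose N := (N0.+1 * n)%N.
have nN : n%:R <= N%:R * (e / 4) :> R.
  rewrite /N natrM mulrC mulrA ler_peMl//.
  by move: N0e; rewrite -(ltr_pM2r (ltr0Sn _ N0)) mulVf// => /ltW.
pose w i := Num.truncn (N%:R * m i).
have [a [na ak aw]] := @code_seq_measure n w n0.
have wm i : (w i)%:R <= N%:R * m i < (w i)%:R + 1.
  by rewrite natr1; apply: truncn_itv; rewrite mulr_ge0.
pose W : R := (\sum_(k < n) w k)%N%:R.
have WN : N%:R * (1 - e / 2) <= W.
  have : N%:R * \sum_(i < n) m i <= W + n%:R.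
    rewrite /W natr_sum mulr_sumr -[X in _ + X%:R]card_ord -sumr_const.
    rewrite -big_split/=; apply: ler_sum => i _.
    by have /andP[_ /ltW] := wm i.
  have : N%:R * (1 - e / 4) <= N%:R * \sum_(i < n) m i.
    by rewrite ler_wpM2l// ltW.
  by move: nN; lra.
have N_gt0 : 0 < N%:R :> R by rewrite ltr0n muln_gt0.
have W0 : 0 < W by apply: lt_le_trans WN; rewrite mulr_gt0//; lra.
have atomsE : atoms a = a.
  by rewrite /atoms aw -(pnatr_eq0 R) -/W gt_eqF.
exists a; apply/prokhorov_ltP; exists e; first by rewrite e0.
move=> A mA; have mV := measurable_enlarge A e.
rewrite pmeas_alphaE (pmeas_fineK mu mV) -EFinD lee_fin.
rewrite /mass /atom_count /atom_index /atom_weight atomsE na aw.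
rewrite prednK; last by rewrite -(ltr_nat R).
rewrite fmorph_div/= !ratr_nat -/W ler_pdivrMr//.
set M := fine _; have M1 : M <= 1.
  by rewrite -lee_fin -pmeas_fineK//; exact: probability_le1.
have M0 : 0 <= M by exact: fine_ge0.
have : (\sum_(k < n) (cm_alpha X (nfst (nnth a k)) \in A) *
    nsnd (nnth a k))%N%:R <= N%:R * M.
  apply: (@le_trans _ _ (N%:R * \sum_(i < n) fine (mu (D i `&` enlarge A e)))).
    rewrite natr_sum mulr_sumr; apply: ler_sum => i _.
    rewrite ak// !npairK; case: (boolP (_ \in _)) => [|_]; last first.
      by rewrite mul0n mulr_ge0// fine_ge0.
    rewrite in_setE mul1n => Ai; have /andP[+ _] := wm i.
    move/le_trans; apply; rewrite ler_wpM2l// /m.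
    suff -> : D i `&` enlarge A e = D i by [].
    apply/setIidPl => x Dx; exists (cm_alpha X i) => //.
    by rewrite metric_sym; exact: subset_seqDU Dx.
  rewrite ler_wpM2l// sumD// fine_le ?fin_num_measure//.
  - by apply: measurableI => //; exact: bigsetU_measurable.
  - apply: le_measure; rewrite ?inE//.
    by apply: measurableI => //; exact: bigsetU_measurable.
(* The cost of dividing by [W]: the defect [N - W] is at most [N * (e / 2)], and [N / 2 <= W]. *)
have : (N%:R - W) * M <= W * e.
  apply: (@le_trans _ _ (N%:R * (e / 2) * M)).
    by rewrite ler_wpM2r//; lra.
  apply: (@le_trans _ _ (N%:R * (e / 2))).
    by rewrite ler_piMr// mulr_ge0// divr_ge0// ltW.
  have : N%:R / 2 <= W by apply: le_trans WN; rewrite ler_wpM2l//; lra.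
  by rewrite -(ler_pM2r e0); lra.
by lra.
Qed.

End density.

(** * From certificates to basic neighbourhoods *)

Section basic_neighbourhoods.
Context {R : realType} {Z : Type} (S U : nat -> set Z).
Variables (sub : nat -> nat -> Prop) (radius : nat -> R).
Hypothesis semidec_sub : semidec (fun m => sub (nfst m) (nsnd m)).
Hypothesis subP : forall i s, sub i s -> U i `<=` S s.
Hypothesis sub_small : forall s z, S s z -> exists2 rho : R, 0 < rho &
  forall i, radius i <= rho -> U i z -> sub i s.
Hypothesis U_small : forall z (rho : R), 0 < rho ->
  exists i, radius i <= rho /\ U i z.

(** A finite list of facts true at [z] follows formally from a single basic set around [z] of small
    radius, and a search over basic sets finds it. The radius is the least of those required by the
    facts. *)
Lemma eff_open_basis (P : Z -> nat -> Prop) : eff_open S P ->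
  exists2 W : nat -> Prop, semidec W &
    forall z n, P z n <-> exists2 i, W (npair i n) & U i z.
Proof.
move=> [V HV VP]; exists (fun m => exists l, V (npair l (nsnd m)) /\
    forall s, s \in seq_of_nat l -> sub (nfst m) s).
  apply: (@semidec_ex (fun m l => V (npair l (nsnd m)) /\
    forall s, s \in seq_of_nat l -> sub (nfst m) s)).
  apply: semidec_and; first by apply: (semidec_comp HV); rec.
  apply: (@semidec_forall_mem (fun m s => sub (nfst (nfst m)) s)).
    by apply: (semidec_comp2 semidec_sub); rec.
  by rec.
move=> z n; rewrite VP; split=> [[l Vl Sl]|[i [l []]]]; last first.
  rewrite !npairK => Vl Sl zi; exists l => // s /Sl h; exact: subP h _ zi.
have [rho rho0 H] : exists2 rho : R, 0 < rho & forall i,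
    radius i <= rho -> U i z -> forall s, s \in seq_of_nat l -> sub i s.
  have {Vl} : forall s, s \in seq_of_nat l -> S s z by exact: Sl.
  elim: (seq_of_nat l) => [_|s t IH Sst]; first by exists 1.
  have [|rho rho0 H] := IH.
    by move=> s' s't; apply: Sst; rewrite inE s't orbT.
  have [rho' rho'0 H'] := sub_small (Sst s (mem_head _ _)).
  exists (Num.min rho rho'); first by rewrite lt_min rho0.
  move=> i; rewrite le_min => /andP[i1 i1'] zi s'.
  by rewrite inE => /predU1P[->|]; [exact: H'|exact: H].
have [i [i1 zi]] := U_small z rho0.
by exists i => //; exists l; rewrite !npairK; split=> //; exact: H.
Qed.

End basic_neighbourhoods.

Lemma eff_open_ball_basis {R : realType} {X : cmspace R} P :
  eff_open (cm_basis X) P -> exists2 W : nat -> Prop, semidec W &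
    forall x n, P x n <-> exists2 i, W (npair i n) & cm_basis X i x.
Proof.
apply: (@eff_open_basis R X _ _ (@subball R X)
  (fun i => ratr (prat_of_nat (nsnd i)))).
- by apply: semidec_subball; rec.
- by move=> i s; exact: subball_sub.
- by move=> s x; exact: subball_small.
- move=> x rho /(prat_between (lexx 0))[e /andP[e0 er]].
  have [a ax] := cm_alpha_near x e0; exists (npair a e).
  by rewrite /cm_basis /ball_basis /= !npairK; split=> //; exact: ltW.
Qed.

(** * Pairs of a measure and a point *)

Section joint.
Context {R : realType} {X : cmspace R}.

Definition joint_subbasis (s : nat) : set (pmeas X * X) :=
  if nfst s == 0%N then [set z | weak_subbasis (nsnd s) z.1]
  else [set z | cm_basis X (nsnd s) z.2].

Definition joint_basis : nat -> set (pmeas X * X) :=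
  prod_basis (pmeas_basis X) (cm_basis X).

Definition sub_joint (i s : nat) : Prop :=
  (nfst s == 0%N /\ @sub_weak R X (nfst i) (nsnd s)) \/
  (nfst s != 0%N /\ @subball R X (nsnd i) (nsnd s)).

Lemma semidec_sub_joint f g : recursive f -> recursive g ->
  semidec (fun n => sub_joint (f n) (g n)).
Proof.
move=> Hf Hg; have H0 : decidable_pred (fun n => nfst (g n) == 0%N).
  by apply: decidable_eq0; rec.
apply: semidec_or; apply: semidec_and.
- exact: decidable_semidec.
- by apply: semidec_sub_weak; rec.
- exact/decidable_semidec/decidable_neg.
- by apply: semidec_subball; rec.
Qed.

Lemma sub_jointP i s : sub_joint i s -> joint_basis i `<=` joint_subbasis s.
Proof.
rewrite /joint_subbasis; case=> [[-> h]|[/negbTE -> h]] z [z1 z2].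
  exact: sub_weakP h _ z1.
exact: subball_sub h _ z2.
Qed.

Definition joint_radius (i : nat) : R :=
  Num.max (ratr (prat_of_nat (nsnd (nfst i))))
          (ratr (prat_of_nat (nsnd (nsnd i)))).

Lemma sub_joint_small s z : joint_subbasis s z -> exists2 rho : R, 0 < rho &
  forall i, joint_radius i <= rho -> joint_basis i z -> sub_joint i s.
Proof.
rewrite /joint_subbasis /sub_joint; case: ifP => _.
  move=> /sub_weak_small[rho rho0 H]; exists rho => // i.
  rewrite ge_max => /andP[ir _] [zi _].
  by left; split=> //; exact: H.
move=> /subball_small[rho rho0 H]; exists rho => // i.
rewrite ge_max => /andP[_ ir] [_ zi].
by right; split=> //; exact: H.
Qed.

Lemma joint_basis_small z (rho : R) : 0 < rho ->
  exists i, joint_radius i <= rho /\ joint_basis i z.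
Proof.
move=> /(prat_between (lexx 0))[e /andP[e0 er]].
have [a az] := prokhorov_dense z.1 e0; have [b bz] := cm_alpha_near z.2 e0.
exists (npair (npair a e) (npair b e)).
rewrite /joint_radius /joint_basis /prod_basis /pmeas_basis /cm_basis.
by rewrite /ball_basis /= !npairK ge_max (ltW er).
Qed.

Lemma eff_open_joint_basis (P : pmeas X * X -> nat -> Prop) :
  eff_open joint_subbasis P -> exists2 W : nat -> Prop, semidec W &
    forall z n, P z n <-> exists2 i, W (npair i n) & joint_basis i z.
Proof.
apply: (@eff_open_basis R _ _ _ sub_joint joint_radius).
- by apply: semidec_sub_joint; rec.
- exact: sub_jointP.
- exact: sub_joint_small.
- exact: joint_basis_small.
Qed.

End joint.

(** * Computable kernels and unions of balls *)

Section borel_functions.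
Context {R : realType} {X : cmspace R}.

Lemma measurable_lsc (f : borel X -> \bar R) :
  (forall r : R, open ([set x | (r%:E < f x)%E] : set X)) ->
  measurable_fun [set: borel X] f.
Proof.
move=> f_open; apply: (measurability _ (ErealGenOInfty.measurableE R)).
move=> /= _ [_ [a ->]] <-; apply: measurableI => //; apply: open_borel.
rewrite preimage_itvoy; exact: f_open.
Qed.

Lemma measurable_mdist (u : X) :
  measurable_fun [set: borel X] (fun x => mdist (x : X) u).
Proof.
(* Open balls give lower semicontinuity of the negated distance, the form that [measurable_lsc]
   accepts. *)
rewrite (_ : (fun x => _) = \- (fun x : borel X => - mdist (x : X) u)).
  apply: measurable_funN; apply/measurable_EFinP; apply: measurable_lsc => r.
  rewrite (_ : mkset _ = [set x | mdist u x < - r]); first exact: open_mball.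
  by apply/seteqP; split=> x /=; rewrite lte_fin metric_sym ltrNr.
by apply/funext => x /=; rewrite opprK.
Qed.

Lemma measurable_hat_fun n :
  measurable_fun [set: borel X] (@hat_fun R X n : borel X -> R).
Proof.
have : hat_class (@hat_fun R X n) by rewrite -range_hat_fun; exists n.
elim=> {n} [|i r n n0|f g _ mf _ mg|f g _ mf _ mg|a b f g _ mf _ mg].
- exact: measurable_cst.
- apply: measurable_maxr; first exact: measurable_cst.
  apply: measurable_funB; first exact: measurable_cst.
  apply: measurable_funM; first exact: measurable_cst.
  apply: measurable_maxr; first exact: measurable_cst.
  by apply: measurable_funB; [exact: measurable_mdist|exact: measurable_cst].
- exact: measurable_maxr.
- exact: measurable_minr.
- by apply: measurable_funD; apply: measurable_funM.
Qed.

End borel_functions.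

(** * Hat functions approximating unions of balls from below *)

Section bumps.
Context {R : realType} {X : cmspace R}.

(* Increases to the indicator of the ball [i] as [n] grows. *)
Definition ball_bump (i n : nat) : X -> R :=
  hat (cm_alpha X (nfst i)) (prat_of_nat (nsnd i) - n.+1%:R^-1) n.+1.

Lemma ball_bump_bounds i n x : 0 <= ball_bump i n x <= 1.
Proof.
rewrite /ball_bump /hat le_max lexx/= ge_max ler01/= gerBl mulr_ge0//.
by rewrite le_max lexx.
Qed.

(** The plateau radius is reduced by exactly the width [1 / n.+1] of the slope, so the bump vanishes
    outside the ball. *)
Lemma ball_bump_gt0 i n x : 0 < ball_bump i n x -> cm_basis X i x.
Proof.
rewrite /ball_bump /hat lt_max ltxx/= subr_gt0 /cm_basis /ball_basis /=.
rewrite metric_sym maxr_pMr// mulr0 gt_max ltr01/=.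
rewrite rmorphB/= fmorphV/= ratr_nat -ltr_pdivlMl// mulr1.
by set v := n.+1%:R^-1; set d := mdist _ _; lra.
Qed.

Lemma ball_bump_eq1 i x : cm_basis X i x ->
  exists N, forall n, (N <= n)%N -> ball_bump i n x = 1.
Proof.
rewrite /cm_basis /ball_basis /= -subr_gt0 => /invS_lt[N NP].
exists N => n Nn; rewrite /ball_bump /hat.
suff -> : Num.max 0 (mdist x (cm_alpha X (nfst i)) -
    ratr (prat_of_nat (nsnd i) - n.+1%:R^-1)) = 0 :> R.
  by rewrite mulr0 subr0; apply/max_idPr.
apply/max_idPl; have : n.+1%:R^-1 <= N.+1%:R^-1 :> R.
  by rewrite lef_pV2 ?posrE// ler_nat.
rewrite rmorphB/= fmorphV/= ratr_nat metric_sym.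
by move: NP; set v := n.+1%:R^-1; set w := N.+1%:R^-1; lra.
Qed.

Definition union_bump (u n k : nat) (x : X) : R :=
  nat_rect (fun=> R) 0 (fun j v => Num.max (ball_bump (nnth u j) n x) v) k.

Lemma union_bump_bounds u n k x : 0 <= union_bump u n k x <= 1.
Proof.
elim: k => [|k /andP[IH0 IH1]]; first by rewrite /= lexx ler01.
have /andP[b0 b1] := ball_bump_bounds (nnth u k) n x.
by rewrite /= le_max b0 ge_max b1.
Qed.

Lemma union_bump_gt0 u n x : 0 < union_bump u n (nsize u) x ->
  ball_union X u x.
Proof.
suff : forall k, (k <= nsize u)%N -> 0 < union_bump u n k x ->
    ball_union X u x by apply.
elim=> [|k IH] ku; first by rewrite ltxx.
rewrite /= lt_max => /orP[/ball_bump_gt0 bx|]; last by apply: IH; exact: ltnW.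
by exists (nnth u k) => //=; exact: mem_nth.
Qed.

Lemma union_bump_eq1 u x : ball_union X u x ->
  exists N, forall n, (N <= n)%N -> union_bump u n (nsize u) x = 1.
Proof.
move=> [_ /(nthP 0%N)[j ju <-] /ball_bump_eq1[N Nx]]; exists N => n /Nx bx.
have : forall k, (j < k)%N -> union_bump u n k x = 1.
  elim=> [//|k IH]; rewrite ltnS leq_eqVlt => /predU1P[<-|/IH kx] /=.
    rewrite [ball_bump _ _ _]bx; apply/max_idPl.
    by have /andP[] := union_bump_bounds u n j x.
  rewrite -/(union_bump u n k x) kx; apply/max_idPr.
  by have /andP[] := ball_bump_bounds (nnth u k) n x.
by apply.
Qed.

Lemma union_bump_code : exists2 h : nat -> nat -> nat,
  recursive (fun m => h (nfst m) (nsnd m)) &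
  forall u n, @hat_fun R X (h u n) = union_bump u n (nsize u).
Proof.
have [r Hr rE] : ratrec (fun m =>
    prat_of_nat (nsnd (nfst m)) - (nsnd m).+1%:R^-1).
  by apply: ratrec_sub; [apply: ratrec_pcode|apply: ratrec_invS]; rec.
have [q0 q0E] := rat_of_nat_surj 0.
(* The zero function as the combination [0 * 1 + 0 * 1]; [npair 0 0] codes the constant 1. *)
pose zero := npair 4 (npair (npair q0 q0) (npair (npair 0 0) (npair 0 0))).
have zeroE : @hat_fun R X zero = fun=> 0.
  rewrite hat_funE /zero !npairK; apply/funext => x /=.
  by rewrite !q0E rmorph0 !mul0r addr0.
pose bump i n := npair 1 (npair (nfst i) (npair (r (npair i n)) n)).
have bumpE i n : @hat_fun R X (bump i n) = ball_bump i n.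
  by rewrite hat_funE /bump !npairK /= -rE !npairK.
exists (fun u n => nat_rec _ zero
  (fun j v => npair 2 (npair (bump (nnth u j) n) v)) (nsize u)).
  apply: (@recursive_nat_rec (fun=> zero) (fun m j v =>
    npair 2 (npair (bump (nnth (nfst m) j) (nsnd m)) v))); rewrite /bump; rec.
move=> u n; elim: (nsize u) => [|k IH] /=; first exact: zeroE.
by rewrite hat_funE /= !npairK bumpE IH.
Qed.

End bumps.

Section computable_kernel.
Context {R : realType} {X1 X0 : cmspace R}.
Variable L : R.-pker (borel X1) ~> (borel X0).

(** The values of a kernel are typed as measures; this alias carries the probability structure
    needed to see [L x] as a [pmeas X0]. *)
Definition kernel_at (x : borel X1) : set (borel X0) -> \bar R := L x.

HB.instance Definition _ x := isMeasure.Build _ _ _ (kernel_at x)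
  (measure0 (L x)) (@measure_ge0 _ _ _ (L x))
  (@measure_semi_sigma_additive _ _ _ (L x)).

HB.instance Definition _ x :=
  Measure_isProbability.Build _ _ _ (kernel_at x) (prob_kernel x).

Definition kernel_pmeas (x : X1) : pmeas X0 := kernel_at (x : borel X1).

(** The bumps stay below the indicator of the union and converge to it pointwise; dominated
    convergence, with bound 1, gives the limit. *)
Lemma kernel_bumps_gtP (x : X1) (u : nat) (b : R) :
  (b%:E < L x (ball_union X0 u))%E <-> exists n,
    b < Rintegral (L x) [set: borel X0] (union_bump u n (nsize u)).
Proof.
have [h _ hE] := @union_bump_code R X0.
pose f n := union_bump (R := R) (X := X0) u n (nsize u).
have mf n : measurable_fun [set: borel X0] (f n : borel X0 -> R).
  by rewrite /f -hE; exact: measurable_hat_fun.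
have f0 n y : 0 <= f n y by have /andP[] := union_bump_bounds u n (nsize u) y.
have f1 n y : f n y <= 1 by have /andP[] := union_bump_bounds u n (nsize u) y.
have mU := @measurable_ball_union R X0 u.
have LU : (\int[L x]_y (\1_(ball_union X0 u) y : R)%:E =
    L x (ball_union X0 u))%E.
  by rewrite integral_indic// setIT.
have fU n : (\int[L x]_y (f n y)%:E <= L x (ball_union X0 u))%E.
  rewrite -LU; apply: ge0_le_integral => //.
  - by move=> y _; rewrite lee_fin.
  - exact/measurable_EFinP.
  - by apply/measurable_EFinP.
  - move=> y _; rewrite lee_fin indicE.
    have [|yU] := boolP (_ \in _); first by rewrite f1.
    rewrite leNgt; apply: contra yU => /union_bump_gt0; rewrite inE; exact.
have L1 : (L x [set: borel X0] = 1)%E by exact: prob_kernel.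
have fine_f n : (Rintegral (L x) [set: borel X0] (f n))%:E =
    (\int[L x]_y (f n y)%:E)%E.
  rewrite /Rintegral fineK// ge0_fin_numE; last first.
    by apply: integral_ge0 => y _; rewrite lee_fin.
  apply: le_lt_trans (fU n) _.
  apply: (@le_lt_trans _ _ (L x setT)); last by rewrite L1 ltry.
  by apply: le_measure; rewrite ?inE//; exact: measurableT.
split=> [bU|[n bn]]; last by apply: lt_le_trans (fU n); rewrite -fine_f lte_fin.
have cvgf : (\int[L x]_y (f n y)%:E @[n --> \oo] --> L x (ball_union X0 u))%E.
  rewrite -LU.
  have [] // := @dominated_convergence _ (borel X0) R (L x) setT measurableT
    (fun n y => (f n y)%:E) (fun y => (\1_(ball_union X0 u) y : R)%:E)
    (cst 1%E).
  - by move=> n; exact/measurable_EFinP.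
  - by apply/measurable_EFinP.
  - apply: aeW => y _; apply: cvg_near_cst; rewrite indicE.
    have [|yU] := boolP (_ \in _).
      rewrite inE => /union_bump_eq1[N Ny].
      by exists N => // n /= /Ny; rewrite /f => ->.
    exists 0%N => // n _; congr _%:E; apply/eqP; rewrite eq_le f0 andbT leNgt.
    by apply: contra yU => /union_bump_gt0; rewrite inE; exact.
  - apply/integrableP; split; first exact: measurable_cst.
    rewrite (eq_integral (cst 1%E)) => [|y _ /=]; last by rewrite normr1.
    by rewrite integral_cst// L1 mule1 ltry.
  - by apply: aeW => y n _ /=; rewrite lee_fin ger0_norm.
have [n fn] := cvge_gt_ex cvgf bU; exists n.
by rewrite -lte_fin fine_f; exact: fn.
Qed.

Lemma eff_open_kernel_hat : computable_kernel L ->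
  eff_open (cm_basis X1) (fun x m => ratr (rat_of_nat (nsnd m)) <
    Rintegral (L x) [set: borel X0] (@hat_fun R X0 (nfst m))).
Proof.
move=> [W /re_set_semidec HW WE].
have {}WE x e j : @real_basis R j
      (Rintegral (L x) [set: borel X0] (@hat_fun R X0 e)) <->
    exists i, W (npair (npair e i) j) /\ cm_basis X1 i x.
  have := congr1 (fun A => A (e, x)) (WE j); rewrite /preimage /= => ->.
  split=> [[i /= Wi [ie ix]]|[i [Wi ix]]].
    by exists (nsnd i); move: ie; rewrite /nat_basis/= => ->; rewrite nunpairK.
  by exists (npair e i) => //=; split; rewrite /= npairK.
(* The real interval [j] starts beyond the threshold: a value exceeds the threshold iff it lies in
   such an interval. *)
pose Q m j := rat_of_nat (nsnd m) < rat_of_nat (nfst j) - prat_of_nat (nsnd j).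
apply: (@eff_open_ext _ _ (fun x m => exists j i,
  (Q m j /\ W (npair (npair (nfst m) i) j)) /\ cm_basis X1 i x)).
  move=> x m; set v := Rintegral _ _ _; split=> [[j [i [[qj Wi] ix]]]|bv].
    have /WE : exists i, W (npair (npair (nfst m) i) j) /\ cm_basis X1 i x.
      by exists i.
    rewrite -/v /real_basis /ball_basis /= ltr_distlC => /andP[+ _].
    apply: lt_trans; move: qj; rewrite /Q -(ltr_rat R) rmorphB/=; exact.
  have d0 : 0 < (v - ratr (rat_of_nat (nsnd m))) / 2.
    by rewrite divr_gt0// subr_gt0.
  have [e /andP[e0 ed]] := prat_between (lexx 0) d0.
  have /rat_in_itvoo[q] : v - ratr (prat_of_nat e) < v by rewrite gtrBl.
  rewrite in_itv/= => /andP[q1 q2]; have [c cq] := rat_of_nat_surj q.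
  have jv : @real_basis R (npair c e) v.
    rewrite /real_basis /ball_basis /= !npairK cq ltr_distlC.
    by apply/andP; split; lra.
  have [i [Wi ix]] := (WE x (nfst m) _).1 jv.
  exists (npair c e), i; split=> //; split=> //.
  by rewrite /Q !npairK cq -(ltr_rat R) rmorphB/=; lra.
apply: (@eff_open_ex _ _ (fun x m j => exists i,
  (Q m j /\ W (npair (npair (nfst m) i) j)) /\ cm_basis X1 i x)).
apply: (@eff_open_ex _ _ (fun x m i =>
  (Q (nfst m) (nsnd m) /\ W (npair (npair (nfst (nfst m)) i) (nsnd m))) /\
  cm_basis X1 i x)).
apply: eff_open_and; last by apply: eff_open_subbasis; rec.
apply: (@eff_open_semidec _ _ (fun m =>
  Q (nfst (nfst m)) (nsnd (nfst m)) /\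
  W (npair (npair (nfst (nfst (nfst m))) (nsnd m)) (nsnd (nfst m))))).
apply: semidec_and; last by apply: (semidec_comp HW); rec.
apply: decidable_semidec; apply: decidable_ltr.
  by apply: ratrec_code; rec.
by apply: ratrec_sub; [apply: ratrec_code|apply: ratrec_pcode]; rec.
Qed.

Lemma eff_open_kernel_weak : computable_kernel L ->
  eff_open (cm_basis X1) (fun x s => weak_subbasis s (kernel_pmeas x)).
Proof.
move=> /eff_open_kernel_hat HL; have [h Hh hE] := @union_bump_code R X0.
apply: (@eff_open_ext _ _ (fun x s => exists n, ratr (rat_of_nat (nsnd s)) <
    Rintegral (L x) [set: borel X0] (@hat_fun R X0 (h (nfst s) n)))).
  move=> x s; rewrite [X in _ <-> X]/weak_subbasis [X in _ <-> X]/=.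
  rewrite kernel_bumps_gtP.
  by split=> -[n nb]; exists n; move: nb; rewrite hE.
apply: (@eff_open_ex _ _ (fun x s n => ratr (rat_of_nat (nsnd s)) <
    Rintegral (L x) [set: borel X0] (@hat_fun R X0 (h (nfst s) n)))).
apply: (eff_open_comp2 (P := fun x m q => ratr (rat_of_nat q) <
  Rintegral (L x) [set: borel X0] (@hat_fun R X0 m)) HL); last by rec.
by apply: (recursive_comp2 Hh); rec.
Qed.

End computable_kernel.

(** * Integrals of lower semicomputable functions *)

Section integration.
Context {R : realType} {Y : cmspace R} {Z : Type}.
Variables (S : nat -> set Z) (m : Z -> pmeas Y).
Variable phi : Z -> nat -> borel Y -> \bar R.
Variable Q : Z -> nat -> Prop.
Hypothesis mphi : forall z p, measurable_fun [set: borel Y] (phi z p).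
Hypothesis phi_ge0 : forall z p y, (0 <= phi z p y)%E.
Hypothesis S_m : eff_open S (fun z s => weak_subbasis s (m z)).
Hypothesis S_Q : eff_open S Q.
Hypothesis QP : forall z p q y, 0 <= rat_of_nat q ->
  ((ratr (rat_of_nat q))%:E < phi z p y)%E <->
  exists i, Q z (npair p (npair i q)) /\ cm_basis Y i y.

Lemma rational_sum_lt (f : nat -> R) K (q : R) : q < \sum_(k < K) f k ->
  exists b : nat -> nat, (forall k, ratr (rat_of_nat (b k)) < f k) /\
    q < \sum_(k < K) ratr (rat_of_nat (b k)).
Proof.
(* The gap is cut into [K.+1] equal parts; the [K] terms spend one each and the last keeps the
   inequality strict. *)
move=> qf; pose d := (\sum_(k < K) f k - q) / K.+1%:R.
have d0 : 0 < d by rewrite divr_gt0// subr_gt0.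
have /choice[b bP] : forall k, exists c, f k - d < ratr (rat_of_nat c) < f k.
  move=> k; have /rat_in_itvoo[r] : f k - d < f k by rewrite gtrBl.
  by have [c <-] := rat_of_nat_surj r; rewrite in_itv/=; exists c.
exists b; split; first by move=> k; have /andP[] := bP k.
apply: (@lt_le_trans _ _ (\sum_(k < K) (f k - d))); last first.
  by apply: ler_sum => k _; have /andP[/ltW] := bP k.
rewrite big_split/= sumr_const card_ord -mulr_natr.
have : d * K.+1%:R = \sum_(k < K) f k - q by rewrite divfK.
by rewrite -natr1 mulrDr mulr1 mulNr; lra.
Qed.

(** A layer sum exceeds its bound iff there are rationals [B] with large enough sum and finite
    unions of balls [u], the [k]-th one inside the [k]-th superlevel set and of measure above the
    [k]-th rational. Both conditions are effectively open. Layer thresholds are positive, so [QP]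
    speaks of nonnegative rationals. *)
Lemma eff_open_integral : eff_open S (fun z n =>
  ((ratr (rat_of_nat (nsnd n)))%:E < \int[m z]_y phi z (nfst n) y)%E).
Proof.
have [c Hc cE] : ratrec (fun n => (nsnd n).+1%:R / (nfst n).+1%:R).
  by apply: ratrec_mul; [apply: ratrec_nat|apply: ratrec_invS]; rec.
pose lev N k := c (npair N k).
have levE N k : rat_of_nat (lev N k) = k.+1%:R / N.+1%:R.
  by rewrite /lev -cE !npairK.
pose good z n N B u k := weak_subbasis (npair (nnth u k) (nnth B k)) (m z) /\
  forall i, i \in seq_of_nat (nnth u k) ->
    Q z (npair (nfst n) (npair i (lev N k))).
pose big n N K B := rat_of_nat (nsnd n) * N.+1%:R <
  \sum_(k < K) rat_of_nat (nnth B k).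
apply: (@eff_open_ext _ _ (fun z n => exists N K B u, big n N K B /\
    forall k, (k < K)%N -> good z n N B u k)).
  move=> z n; set q : R := ratr _; set p := nfst n.
  pose E N k := [set y | ((k.+1%:R / N.+1%:R)%:E < phi z p y)%E].
  have EE N k : E N k = \bigcup_(i in
      [set i | Q z (npair p (npair i (lev N k)))]) cm_basis Y i.
    apply/seteqP; split=> y; rewrite /E /=.
      have -> : k.+1%:R / N.+1%:R = ratr (rat_of_nat (lev N k)) :> R.
        by rewrite levE fmorph_div/= !ratr_nat.
      rewrite QP; last by rewrite levE divr_ge0.
      by move=> [i [Qi iy]]; exists i.
    move=> [i /= Qi iy].
    have -> : k.+1%:R / N.+1%:R = ratr (rat_of_nat (lev N k)) :> R.
      by rewrite levE fmorph_div/= !ratr_nat.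
    by rewrite QP; [exists i|rewrite levE divr_ge0].
  have mB i : measurable (cm_basis Y i : set (borel Y)).
    by apply: open_borel; exact: open_cm_basis.
  have mE N k : measurable (E N k : set (borel Y)).
    by rewrite EE; exact: bigcup_measurable.
  have bigE N K B : big n N K B <->
      q * N.+1%:R < \sum_(k < K) ratr (rat_of_nat (nnth B k)).
    rewrite /big -(ltr_rat R) rmorphM/= ratr_nat rmorph_sum/=.
    by split.
  rewrite integral_gt_layersP//; split.
    move=> [N [K [B [u [/bigE bg gd]]]]]; exists N, K.
    apply: (@lt_le_trans _ _
      (\sum_(k < K) ratr (rat_of_nat (nnth B k)))%:E); first by rewrite lte_fin.
    rewrite -sumEFin; apply: lee_sum => k _.
    have [] := gd k (ltn_ord k); rewrite /weak_subbasis /= !npairK => /ltW h Qu.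
    apply: (le_trans h); apply: le_measure; rewrite ?inE//.
    - exact: measurable_ball_union.
    - exact: mE.
    - rewrite -/(E N k) EE; exact: bigcup_subset.
  move=> [N [K]].
  rewrite (eq_bigr (fun k : 'I_K => (fine (m z (E N k)))%:E)) => [|k _];
    last first.
    by rewrite -pmeas_fineK//; exact: mE.
  rewrite sumEFin lte_fin.
  move=> /(rational_sum_lt (f := fun k => fine (m z (E N k))))[b [bE qb]].
  have /choice[l lP] : forall k, exists l,
      (forall i, i \in seq_of_nat l -> Q z (npair p (npair i (lev N k)))) /\
      ((ratr (rat_of_nat (b k)))%:E < m z (ball_union Y l))%E.
    move=> k; have := bE k; rewrite -lte_fin -pmeas_fineK; last exact: mE.
    by rewrite EE => /(measure_bigcup_gtP _ mB)[l lQ bl]; exists l.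
  have [B BE] := seq_of_nat_surj (mkseq b K).
  have [u uE] := seq_of_nat_surj (mkseq l K).
  have Bk k : (k < K)%N -> nnth B k = b k.
    by move=> kK; rewrite /nnth BE nth_mkseq.
  have uk k : (k < K)%N -> nnth u k = l k.
    by move=> kK; rewrite /nnth uE nth_mkseq.
  exists N, K, B, u; split.
    by apply/bigE; under eq_bigr => k _ do rewrite Bk//.
  move=> k kK; have [lQ lm] := lP k; rewrite /good uk// Bk//; split=> //.
  by rewrite /weak_subbasis /= !npairK.
apply: (@eff_open_ex _ _ (fun z n N => exists K B u, big n N K B /\
    forall k, (k < K)%N -> good z n N B u k)).
apply: (@eff_open_ex _ _ (fun z n K => exists B u,
    big (nfst n) (nsnd n) K B /\
    forall k, (k < K)%N -> good z (nfst n) (nsnd n) B u k)).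
apply: (@eff_open_ex _ _ (fun z n B => exists u,
    big (nfst (nfst n)) (nsnd (nfst n)) (nsnd n) B /\
    forall k, (k < nsnd n)%N ->
      good z (nfst (nfst n)) (nsnd (nfst n)) B u k)).
apply: (@eff_open_ex _ _ (fun z n u =>
    big (nfst (nfst (nfst n))) (nsnd (nfst (nfst n))) (nsnd (nfst n)) (nsnd n) /\
    forall k, (k < nsnd (nfst n))%N ->
      good z (nfst (nfst (nfst n))) (nsnd (nfst (nfst n))) (nsnd n) u k)).
apply: eff_open_and.
  apply: (@eff_open_semidec _ _ (fun m => let n := nfst m in
    big (nfst (nfst (nfst n))) (nsnd (nfst (nfst n))) (nsnd (nfst n)) (nsnd n))).
  apply: decidable_semidec; apply: decidable_ltr.
    by apply: ratrec_mul; [apply: ratrec_code|apply: ratrec_nat]; rec.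
  apply: (@ratrec_sum (fun m k => rat_of_nat (nnth (nsnd (nfst m)) k))).
    by apply: ratrec_code; rec.
  by rec.
apply: (@eff_open_forall_lt _ _ (fun z m k => let n := nfst m in
  good z (nfst (nfst (nfst n))) (nsnd (nfst (nfst n))) (nsnd n) (nsnd m) k));
  last by rec.
apply: eff_open_and.
  by apply: (eff_open_comp S_m); rec.
apply: (@eff_open_forall_mem _ _ (fun z m i => let n := nfst (nfst m) in
  Q z (npair (nfst (nfst (nfst (nfst n))))
    (npair i (lev (nsnd (nfst (nfst n))) (nsnd m)))))); last by rec.
apply: (eff_open_comp S_Q); rewrite /lev; cbv zeta; rec.
Qed.

End integration.

(** * The image measure *)

(** [pmeas_basisP] makes a Prokhorov ball a union over [e] of bounded intersections of
    [weak_subbasis] facts, with codes recursive in the index. *)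
Lemma eff_open_pmeas_basis {R : realType} (X : cmspace R) :
  eff_open (@weak_subbasis R X) (fun nu i => pmeas_basis X i nu).
Proof.
have [v Hv vE] : ratrec (fun m =>
    mass (nfst m) (nbit (nfst (nsnd m))) - prat_of_nat (nsnd (nsnd m))).
  by apply: ratrec_sub; [apply: ratrec_mass_nbit|apply: ratrec_pcode]; rec.
pose good (nu : pmeas X) i e c := weak_subbasis
  (npair (atom_balls (nfst i) c e) (v (npair (nfst i) (npair c e)))) nu.
apply: (@eff_open_ext _ _ (fun nu i => exists e,
    prat_of_nat e < prat_of_nat (nsnd i) /\
    forall c, (c < 2 ^ atom_count (nfst i))%N -> good nu i e c)).
  move=> nu i; rewrite pmeas_basisP.
  by split=> -[e [er H]]; exists e; split=> // c /H;
    rewrite /good /weak_subbasis /= !npairK -vE !npairK.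
apply: (@eff_open_ex _ _ (fun nu i e =>
    prat_of_nat e < prat_of_nat (nsnd i) /\
    forall c, (c < 2 ^ atom_count (nfst i))%N -> good nu i e c)).
apply: eff_open_and.
  apply: (@eff_open_semidec _ _ (fun m =>
    prat_of_nat (nsnd m) < prat_of_nat (nsnd (nfst m)))).
  by apply/decidable_semidec/decidable_ltr; apply: ratrec_pcode; rec.
apply: (@eff_open_forall_lt _ _ (fun nu m c => good nu (nfst m) (nsnd m) c)).
  apply: eff_open_subbasis; rec.
  by apply: recursive_atom_balls; rec.
by apply/recursive_exp2/recursive_atom_count; rec.
Qed.

Section push.
Context {R : realType} {X1 X0 : cmspace R}.
Variable L : R.-pker (borel X1) ~> (borel X0).

Lemma integral_kernel_pmeas (x : X1) (h : borel X0 -> \bar R) :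
  (\int[L x]_y h y = \int[kernel_pmeas L x]_y h y)%E.
Proof. exact: eq_measure_integral. Qed.

(** [pmeas_push L mu] agrees on measurable sets with the bind of the Giry monad, for which this
    integral formula is known. *)
Lemma integral_pmeas_push (mu : pmeas X1) (h : borel X0 -> \bar R) :
  measurable_fun [set: borel X0] h -> (forall y, 0 <= h y)%E ->
  (\int[pmeas_push L mu]_y h y = \int[mu]_x \int[L x]_y h y)%E.
Proof.
move=> mh h0.
have mL : measurable_fun [set: borel X1]
    (fun x => kernel_pmeas L x : giry (borel X0) R).
  by apply: measurable_giry_codensity => // B mB; exact: measurable_kernel.
have := giry_int_bind (mu : giry (borel X1) R) mL mh h0.
rewrite /giry_int => <-; apply: eq_measure_integral => A mA _.
rewrite /giry_bind /giry_join/=.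
by rewrite [RHS](giry_int_map mL)//; exact: measurable_giry_ev.
Qed.

Lemma eff_open_push_weak : computable_kernel L ->
  eff_open (@weak_subbasis R X1)
    (fun mu s => weak_subbasis s (pmeas_push L mu)).
Proof.
(* Integration wants superlevel sets as unions of single balls, not of finite intersections. [W]
   does not depend on the measure; only the order of its indices is changed below. *)
move=> /(eff_open_kernel_weak)/eff_open_ball_basis[W HW WP].
have H := @eff_open_integral R X1 (pmeas X1) (@weak_subbasis R X1) id
  (fun _ p x => L x (ball_union X0 p))
  (fun _ n => W (npair (nfst (nsnd n)) (npair (nfst n) (nsnd (nsnd n))))).
apply: (@eff_open_ext _ _ _ _ _ (eff_open_comp (H _ _ _ _ _) recursive_id)).
- by [].
- by move=> _ p; exact: measurable_kernel (measurable_ball_union _).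
- by [].
- exact: eff_open_subbasis recursive_id.
- apply: (@eff_open_semidec _ _ (fun n =>
    W (npair (nfst (nsnd n)) (npair (nfst n) (nsnd (nsnd n)))))).
  by apply: (semidec_comp HW); rec.
- move=> _ p q x _; have := WP x (npair p q); rewrite /weak_subbasis /= !npairK.
  move=> ->; split=> [[i Wi ix]|[i []]]; first by exists i; rewrite !npairK.
  by rewrite !npairK => Wi ix; exists i.
Qed.

Lemma eff_open_push_basis : computable_kernel L ->
  eff_open (@weak_subbasis R X1)
    (fun mu i => pmeas_basis X0 i (pmeas_push L mu)).
Proof.
move=> cL; exact: eff_open_preimage (eff_open_push_weak cL)
  (eff_open_pmeas_basis X0).
Qed.

End push.

Section joint_projections.
Context {R : realType} {X : cmspace R}.

Lemma eff_open_joint_fst :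
  eff_open (@joint_subbasis R X) (fun z s => weak_subbasis s z.1).
Proof.
apply: (@eff_open_ext _ _ (fun z s => joint_subbasis (npair 0 s) z)).
  by move=> z s; rewrite /joint_subbasis !npairK.
by apply: (@eff_open_subbasis _ _ (fun s => npair 0 s)); rec.
Qed.

Lemma eff_open_joint_snd :
  eff_open (@joint_subbasis R X) (fun z s => cm_basis X s z.2).
Proof.
apply: (@eff_open_ext _ _ (fun z s => joint_subbasis (npair 1 s) z)).
  by move=> z s; rewrite /joint_subbasis !npairK.
by apply: (@eff_open_subbasis _ _ (fun s => npair 1 s)); rec.
Qed.

End joint_projections.

(** * Lower semicomputable functions *)

Section lower_semicomputable.
Context {R : realType} {Z : Type} (U : nat -> set Z).

Lemma lower_semicomputableP (f : Z -> \bar R) : lower_semicomputable U f ->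
  exists2 A : nat -> Prop, semidec A & forall z (r : R),
    (r%:E < f z)%E <-> exists i,
      [/\ A i, U (nfst i) z & @real_basis R (nsnd i) r].
Proof.
move=> [A /re_set_semidec HA AE]; exists A => // z r.
have := congr1 (fun B => B (z, r)) AE; rewrite /= => ->.
by split=> [[i Ai [iz ir]]|[i [Ai iz ir]]]; exists i.
Qed.

Lemma lower_semicomputable_basis (f : Z -> \bar R) (W : nat -> Prop) :
  semidec W ->
  (forall z q, ((ratr (rat_of_nat q))%:E < f z)%E <->
    exists2 i, W (npair i q) & U i z) ->
  lower_semicomputable U f.
Proof.
(* Real thresholds come from rational ones: each basic set is paired with the intervals whose right
   end is at most a certified rational [q]. *)
move=> HW WP; pose A n := exists q, W (npair (nfst n) q) /\
  rat_of_nat (nfst (nsnd n)) + prat_of_nat (nsnd (nsnd n)) <= rat_of_nat q.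
exists [set n | A n].
  apply/re_set_semidec; apply: (@semidec_ex (fun n q =>
    W (npair (nfst n) q) /\ rat_of_nat (nfst (nsnd n)) +
      prat_of_nat (nsnd (nsnd n)) <= rat_of_nat q)).
  apply: semidec_and; first by apply: (semidec_comp HW); rec.
  apply/decidable_semidec/decidable_ler; last by apply: ratrec_code; rec.
  by apply: ratrec_add; [apply: ratrec_code|apply: ratrec_pcode]; rec.
apply/seteqP; split=> -[z r] /=; last first.
  move=> [n [q [Wq nq]] [/= nz]]; rewrite /real_basis /ball_basis /=.
  rewrite ltr_distlC => /andP[_ rn].
  apply: (@lt_trans _ _ (ratr (rat_of_nat q))%:E).
    rewrite lte_fin; apply: lt_le_trans rn _.
    by move: nq; rewrite -(ler_rat R) rmorphD.
  by apply/WP; exists (nfst n).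
move=> rf; have [q [rq qf]] : exists q, r < ratr (rat_of_nat q) /\
    ((ratr (rat_of_nat q))%:E < f z)%E.
  have [v rv vf] : exists2 v : R, r < v & (v%:E <= f z)%E.
    case: (f z) rf => [v||]//; first by rewrite lte_fin => rv; exists v.
    by exists (r + 1); rewrite ?ltrDl ?leey.
  have [q] := rat_in_itvoo rv; have [c <-] := rat_of_nat_surj q.
  rewrite in_itv/= => /andP[rc cv]; exists c; split=> //.
  by apply: lt_le_trans vf; rewrite lte_fin.
have [i Wi iz] := (WP z q).1 qf.
have : 0 < ratr (rat_of_nat q) - r by rewrite subr_gt0.
(* With [e < q - r] and a centre in [(r - e, r)], the interval contains [r] and ends before [q]. *)
move=> /(prat_between (lexx 0))[e /andP[e0 eq]].
have /rat_in_itvoo[b] : r - ratr (prat_of_nat e) < r by rewrite gtrBl.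
have [c <-] := rat_of_nat_surj b; rewrite in_itv/= => /andP[c1 c2].
exists (npair i (npair c e)).
  exists q; rewrite !npairK; split=> //.
  by rewrite -(ler_rat R) rmorphD/=; lra.
split; rewrite /= !npairK // /real_basis /ball_basis /= !npairK.
by rewrite ltr_distlC; apply/andP; split; lra.
Qed.

End lower_semicomputable.

Lemma measurable_test {R : realType} {X : cmspace R}
    (t : pmeas X -> X -> \bar R) (mu : pmeas X) :
  randomness_test t -> measurable_fun [set: borel X] (t mu : borel X -> \bar R).
Proof.
move=> [_ /lower_semicomputableP[A _ AP] _]; apply: measurable_lsc => r.
rewrite (_ : mkset _ = \bigcup_(i in [set i | [/\ A i,
    pmeas_basis X (nfst (nfst i)) mu & @real_basis R (nsnd i) r]])
    cm_basis X (nsnd (nfst i))).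
  by apply: bigcup_open => i _; exact: open_cm_basis.
apply/seteqP; split=> x /=.
  by move=> /(AP (mu, x))[i [Ai [/= imu ix] ir]]; exists i.
by move=> [i /= [Ai imu ir] ix]; apply/(AP (mu, x)); exists i.
Qed.

(** * The test induced by the kernel *)

Section kernel_test.
Context {R : realType} {X1 X0 : cmspace R}.
Variables (t0 : pmeas X0 -> X0 -> \bar R).
Variables (L : R.-pker (borel X1) ~> (borel X0)).
Hypotheses (t0_test : randomness_test t0) (cL : computable_kernel L).

Definition kernel_test (mu : pmeas X1) (x : X1) : \bar R :=
  (\int[L x]_(y in [set: borel X0]) t0 (pmeas_push L mu) y)%E.

Lemma lower_semicomputable_kernel_test :
  lower_semicomputable (prod_basis (pmeas_basis X1) (cm_basis X1))
    (fun z => kernel_test z.1 z.2).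
Proof.
have [t0_ge0 /lower_semicomputableP[A HA AP] _] := t0_test.
pose in_real j q :=
  rat_of_nat (nfst j) - prat_of_nat (nsnd j) < rat_of_nat q /\
  rat_of_nat q < rat_of_nat (nfst j) + prat_of_nat (nsnd j).
have in_realE j q : @real_basis R j (ratr (rat_of_nat q)) <-> in_real j q.
  rewrite /real_basis /ball_basis /= ltr_distlC /in_real.
  by rewrite -!(ltr_rat R) rmorphB rmorphD/=; split=> [/andP[]|[-> ->]].
(* [a] is an enumerated box below the graph of [t0]: its point ball is the ball in question, its
   interval contains the threshold, and its measure ball contains the image measure, an effectively
   open condition on [z.1]. *)
pose Q (z : pmeas X1 * X1) n := exists a,
  (A a /\ nfst (nsnd n) = nsnd (nfst a) /\ in_real (nsnd a) (nsnd (nsnd n))) /\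
  pmeas_basis X0 (nfst (nfst a)) (pmeas_push L z.1).
have HI : eff_open (@joint_subbasis R X1) (fun z n =>
    ((ratr (rat_of_nat (nsnd n)))%:E <
     \int[kernel_pmeas L z.2]_y t0 (pmeas_push L z.1) y)%E).
  apply: (@eff_open_integral R X0 _ _ (fun z => kernel_pmeas L z.2)
    (fun z _ => t0 (pmeas_push L z.1)) Q).
  - by move=> z _; exact: measurable_test t0_test.
  - by move=> z _ y; exact: t0_ge0.
  - apply: (eff_open_preimage (h := snd)) (eff_open_kernel_weak cL).
    exact: eff_open_joint_snd.
  - apply: (@eff_open_ex _ _ (fun z n a => (A a /\
      nfst (nsnd n) = nsnd (nfst a) /\ in_real (nsnd a) (nsnd (nsnd n))) /\
      pmeas_basis X0 (nfst (nfst a)) (pmeas_push L z.1))).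
    apply: eff_open_and; last first.
      apply: (eff_open_comp (P := fun z i =>
        pmeas_basis X0 i (pmeas_push L z.1))); last by rec.
      apply: (eff_open_preimage (h := fst)) (eff_open_push_basis cL).
      exact: eff_open_joint_fst.
    apply: (@eff_open_semidec _ _ (fun m => A (nsnd m) /\
      nfst (nsnd (nfst m)) = nsnd (nfst (nsnd m)) /\
      in_real (nsnd (nsnd m)) (nsnd (nsnd (nfst m))))).
    apply: semidec_and; first by apply: (semidec_comp HA); rec.
    apply: semidec_and.
      apply: (@semidec_ext (fun m =>
        nfst (nsnd (nfst m)) == nsnd (nfst (nsnd m)))).
        by move=> m; split=> /eqP.
      by apply/decidable_semidec/decidable_eqn; rec.
    by apply: semidec_and; apply/decidable_semidec/decidable_ltr;
      do ?[apply: ratrec_sub|apply: ratrec_add];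
      do ?[apply: ratrec_code|apply: ratrec_pcode]; rec.
  - move=> z p q y _; have := AP (pmeas_push L z.1, y) (ratr (rat_of_nat q)).
    move=> /= ->; split.
      move=> [a [Aa [/= az ay] /in_realE ar]]; exists (nsnd (nfst a)).
      by split=> //; exists a; rewrite !npairK.
    move=> [i [[a [[Aa []]]]]]; rewrite !npairK => -> ar az ay.
    by exists a; split=> //; exact/in_realE.
have [W HW WP] := eff_open_joint_basis HI.
(* There is a single integrand, so the parameter of [eff_open_integral] is set to 0. *)
apply: (lower_semicomputable_basis
  (W := fun m => W (npair (nfst m) (npair 0 (nsnd m))))).
  by apply: (semidec_comp HW); rec.
move=> z q; have := WP z (npair 0 q); rewrite npairK => h.
rewrite /kernel_test integral_kernel_pmeas h.
by split=> -[i Wi zi]; exists i => //; move: Wi; rewrite !npairK.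
Qed.

Lemma randomness_test_kernel_test : randomness_test kernel_test.
Proof.
have [t0_ge0 _ t0_le1] := t0_test; split.
- by move=> mu x; apply: integral_ge0 => y _; exact: t0_ge0.
- exact: lower_semicomputable_kernel_test.
- move=> mu; rewrite -integral_pmeas_push; first exact: t0_le1.
    exact: measurable_test.
  exact: t0_ge0.
Qed.

End kernel_test.

Theorem theorem3p4 (R : realType) (X1 X0 : cmspace R)
  (rbi1 : recognizable_boolean_inclusions X1)
  (rbi0 : recognizable_boolean_inclusions X0)
  (t1 : pmeas X1 -> X1 -> \bar R) (univ1 : universal_test t1)
  (t0 : pmeas X0 -> X0 -> \bar R) (univ0 : universal_test t0)
  (L : R.-pker (borel X1) ~> (borel X0)) (compL : computable_kernel L) :
  exists2 c : R, 0 < c & forall (mu : pmeas X1) (x : X1),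
    (\int[L x]_(y in [set: borel X0]) t0 (pmeas_push L mu) y
       <= c%:E * t1 mu x)%E.
Proof.
have [_ t1_univ] := univ1; have [t0_test _] := univ0.
have [c c0 ct1] := t1_univ _ (randomness_test_kernel_test t0_test compL).
exists c^-1; first by rewrite invr_gt0.
move=> mu x; rewrite lee_pdivlMl//; exact: ct1.
Qed.
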